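(* Every flotilla-galaxy $H$ satisfies the Erdős–Hajnal Conjecture: there exists $\epsilon(H)>0$ such that every $H$-free tournament $T$ with $n$ vertices contains a transitive subtournament with at least $n^{\epsilon(H)}$ vertices.
   Context: A tournament is a digraph in which for every pair of distinct vertices $u,v$ exactly one of the arcs $(u,v),(v,u)$ is present; it is transitive if it has no directed cycle. A tournament $T$ contains $H$ if $H$ is isomorphic to the subtournament of $T$ induced by some vertex subset; otherwise $T$ is $H$-free. Let $\theta=(v_1,\dots,v_n)$ be an ordering of the vertices of a tournament $T$. An arc $(v_i,v_j)$ is backward under $\theta$ if $i>j$. The graph of backward arcs $B(T,\theta)$ is the undirected graph on $V(T)$ in which $v_iv_j$ is an edge iff $(v_i,v_j)$ or $(v_j,v_i)$ is a backward arc. A vertex $v_j$ is between $v_i$ and $v_k$ if $i<j<k$ or $k<j<i$. A left boat in $B(T,\theta)$ is a set $\{v_{i_1},v_{i_2},v_{i_3},v_{i_4}\}$ with $i_1<i_2<i_3<i_4$ and $i_3=i_2+1=i_1+2$ such that the subgraph of $B(T,\theta)$ induced on it has exactly the edges $v_{i_1}v_{i_3}$, $v_{i_1}v_{i_4}$, $v_{i_2}v_{i_4}$ (this is the graph of backward arcs of the 4-vertex tournament ''boat'' with arcs $y\to x, y\to u, v\to x, x\to u, u\to v, v\to y$ under the ordering $(x,u,v,y)$). A right boat is defined in the same way except that instead $i_4=i_3+1=i_2+2$ (i.e. $v_{i_2},v_{i_3},v_{i_4}$ are consecutive in $\theta$). A right star in $B(T,\theta)$ is a set $\{v_{i_0},\dots,v_{i_t}\}$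 ($t\ge1$) inducing in $B(T,\theta)$ a star $K_{1,t}$ with center $v_{i_t}$, where $i_t>i_0,\dots,i_{t-1}$; a left star is such a set inducing a star with center $v_{i_0}$, where $i_0<i_1,\dots,i_t$; the other vertices are leaves (when $t=1$ either vertex may be designated the center). A star is a left star or a right star. A tournament $T$ is a flotilla-galaxy if there is an ordering $\theta$ of $V(T)$ such that every connected component of $B(T,\theta)$ is a star, a singleton, a left boat or a right boat, and moreover: no center of a star is between two leaves of another star, and no vertex of a left boat or of a right boat is between two leaves of a star. *)

(* Defs.v *)
From mathcomp Require Import all_boot.

Set Implicit Arguments.
Unset Strict Implicit.
Unset Printing Implicit Defensive.

Record tournament := Tournament {
  vertex :> finType;
  tarc : rel vertex;
  tarc_irr : irreflexive tarc;
  tarc_xor : forall u v, u != v -> tarc u v (+) tarc v u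
}.

Definition isomorphic (T1 T2 : tournament) : Prop :=
  exists2 f : T1 -> T2, bijective f & {mono f : u v / tarc u v}.

Section Subtournament.
Variables (T : tournament) (S : {set T}).

Definition sub_tarc : rel {u : T | u \in S} :=
  fun u v => tarc (val u) (val v).

Lemma sub_tarc_irr : irreflexive sub_tarc.
Proof. by move=> u; apply: tarc_irr. Qed.

Lemma sub_tarc_xor u v : u != v -> sub_tarc u v (+) sub_tarc v u.
Proof. by move=> uv; apply: tarc_xor. Qed.

Definition subtournament : tournament := Tournament sub_tarc_irr sub_tarc_xor.

End Subtournament.

Definition contains (T H : tournament) : Prop :=
  exists S : {set T}, isomorphic H (subtournament S).

Definition tournament_free (H T : tournament) : Prop := ~ contains T H.

Definition transitive_tournament (T : tournament) : Prop :=
  forall p : seq T, ucycle (@tarc T) p -> p = [::].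

Section Ordering.
(* An ordering (v_0, ..., v_(n-1)) of the n vertices is given by the map
   sending v_i to i; being injective, this map is a bijection. *)
Variables (T : tournament) (theta : T -> 'I_#|T|).

Definition backward : rel T := fun u v => tarc u v && (theta v < theta u)%N.

Definition bgraph : rel T := fun u v => backward u v || backward v u.

Definition bcomponents : {set {set T}} :=
  [set [set v | connect bgraph u v] | u : T].

Definition between (w u v : T) : bool :=
  (theta u < theta w < theta v)%N || (theta v < theta w < theta u)%N.

Definition induces_star (S : {set T}) (c : T) : Prop :=
  [/\ c \in S, (1 < #|S|)%N &
      {in S &, forall u v, bgraph u v = (u == c) (+) (v == c)}].

Definition right_star (S : {set T}) (c : T) : Prop :=
  induces_star S c /\ {in S :\ c, forall u, (theta u < theta c)%N}.

Definition left_star (S : {set T}) (c : T) : Prop :=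
  induces_star S c /\ {in S :\ c, forall u, (theta c < theta u)%N}.

Definition star (S : {set T}) (c : T) : Prop := left_star S c \/ right_star S c.

Definition induces_boat (v1 v2 v3 v4 : T) : bool :=
  [&& bgraph v1 v3, bgraph v1 v4, bgraph v2 v4,
      ~~ bgraph v1 v2, ~~ bgraph v2 v3 & ~~ bgraph v3 v4].

Definition left_boat (S : {set T}) : Prop :=
  exists v1 v2 v3 v4 : T,
    [/\ S = [set v1; v2; v3; v4],
        theta v2 = (theta v1).+1 :> nat, theta v3 = (theta v2).+1 :> nat,
        (theta v3 < theta v4)%N & induces_boat v1 v2 v3 v4].

Definition right_boat (S : {set T}) : Prop :=
  exists v1 v2 v3 v4 : T,
    [/\ S = [set v1; v2; v3; v4],
        (theta v1 < theta v2)%N, theta v3 = (theta v2).+1 :> nat,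
        theta v4 = (theta v3).+1 :> nat & induces_boat v1 v2 v3 v4].

(* C is a set of designated centers: it singles out one vertex of each star
   component, which is a genuine choice only for components with 2 vertices. *)
Definition star_component (C S : {set T}) (c : T) : Prop :=
  [/\ S \in bcomponents, C :&: S = [set c] & star S c].

Definition flotilla_galaxy_ordering (C : {set T}) : Prop :=
  [/\ {in bcomponents, forall S : {set T},
        [\/ exists c, star_component C S c, #|S| = 1%N,
            left_boat S | right_boat S]},
      forall (S S' : {set T}) (c c' : T),
        star_component C S c -> star_component C S' c' -> S != S' ->
        {in S' :\ c' &, forall u v, ~~ between c u v} &
      forall (S S' : {set T}) (c' : T),
        S \in bcomponents -> left_boat S \/ right_boat S ->
        star_component C S' c' ->
        {in S, forall w, {in S' :\ c' &, forall u v, ~~ between w u v}}].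

End Ordering.

Definition flotilla_galaxy (T : tournament) : Prop :=
  exists theta : T -> 'I_#|T|,
    injective theta /\ exists C : {set T}, flotilla_galaxy_ordering theta C.

(* Main.v *)
Require Import Defs.
From mathcomp Require Import all_classical all_reals all_analysis.
From mathcomp Require Import all_boot all_order all_algebra.
From mathcomp Require Import zify ring lra.

(* Let V be a minimal vertex set whose largest transitive subset has size
   tr V < |V|^eps, with eps tiny. Minimality makes tr almost insensitive to
   passing to a subset of linear size, so a transitive set of size
   proportional to tr V is never complete to or from a set of linear size.
   H-freeness gives, by greedy embedding, a long sequence of linear sets in
   which almost all arcs go forward; every second set can then be replaced by
   a transitive subset of size proportional to tr V. The components of the
   backward graph of H are embedded one by one, centres of stars and vertices
   of boats in linear sets, leaves in consecutive pieces of the transitive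
   sets: the condition on H says that the leaves of a star fit in a single
   transitive set. For a star, if no vertex of the linear set were a centre,
   then by pigeonhole a piece would be complete to a linear set.

   For a boat, let S, W be linear, where each y in W has few out-neighbours
   N(y) in S. If there is no boat with three vertices in S and the fourth in
   W, then calling two vertices of N(y) twins when they have the same
   in-neighbours in S \ N(y) splits N(y) into classes that are complete to one
   another in a linear order, and homogeneous to S \ N(y). Hence the numbers
   tr of the classes add up to at most tr V, and a largest transitive subset M
   of A meets a class k either trivially or in at least |A :&: k|^eps vertices.
   Remove largest transitive sets from S until only half of S remains. Each
   class k is hit by O(|k|^(1-eps)) of them, and these bounds add up, over the
   classes of one y, to less than half the number of removed sets. So some
   removed set is complete to more than half of W, which is impossible. *)

Set Implicit Arguments.
Unset Strict Implicit.
Unset Printing Implicit Defensive.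

(** * Transitive sets *)

Section TransitiveSets.
Variables (T : finType) (e : rel T).

(** Excluding cyclic triangles is enough: a tournament with a directed cycle has one of length
    three. *)
Definition trans (X : {set T}) : bool :=
  [forall x in X, forall y in X, forall z in X, ~~ [&& e x y, e y z & e z x]].

Lemma transP (X : {set T}) :
  reflect {in X & & , forall x y z, e x y -> e y z -> ~~ e z x} (trans X).
Proof.
apply: (iffP forall_inP) => [h x y z xX yX zX xy yz|h x xX].
  by move/forall_inP/(_ y yX)/forall_inP/(_ z zX): (h x xX); rewrite xy yz.
apply/forall_inP => y yX; apply/forall_inP => z zX.
by apply/negP => /and3P[xy yz]; apply/negP; apply: h xy yz.
Qed.

Lemma trans_sub (X Y : {set T}) : X \subset Y -> trans Y -> trans X.
Proof.
move=> /subsetP XY /transP h; apply/transP => x y z xX yX zX.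
by apply: h; apply: XY.
Qed.

Definition tr (A : {set T}) : nat :=
  \max_(X : {set T} | (X \subset A) && trans X) #|X|.

Lemma leq_tr (X A : {set T}) : X \subset A -> trans X -> #|X| <= tr A.
Proof.
by move=> XA tX; apply: (bigmax_sup X) => //; rewrite XA.
Qed.

Lemma trans0 : trans set0.
Proof. by apply/transP => x y z; rewrite inE. Qed.

Lemma tr_witness (A : {set T}) :
  exists X : {set T}, [/\ X \subset A, trans X & #|X| = tr A].
Proof.
have [|X /andP[XA tX] eqX] := @eq_bigmax_cond _
    [pred X : {set T} | (X \subset A) && trans X] (fun X : {set T} => #|X|).
  by apply/card_gt0P; exists set0; rewrite !inE sub0set trans0.
by exists X; split => //; rewrite -eqX.
Qed.

Lemma tr_mono (A B : {set T}) : A \subset B -> tr A <= tr B.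
Proof.
move=> AB; have [X [XA tX <-]] := tr_witness A.
by apply: leq_tr => //; apply: subset_trans AB.
Qed.

Lemma tr_leq_card (A : {set T}) : tr A <= #|A|.
Proof. by have [X [XA _ <-]] := tr_witness A; apply: subset_leq_card. Qed.

Definition complete (X Y : {set T}) : Prop := {in X & Y, forall x y, e x y}.

Hypotheses (e_irr : irreflexive e)
           (e_xor : forall u v, u != v -> e u v (+) e v u).

Lemma arc_asym u v : e u v -> ~~ e v u.
Proof.
have [->|uv h] := eqVneq u v; first by rewrite e_irr.
by move: (e_xor uv); rewrite h addTb.
Qed.

Lemma arc_total u v : u != v -> ~~ e u v -> e v u.
Proof. by move=> uv /negbTE h; move: (e_xor uv); rewrite h. Qed.

Lemma arc_neq u v : e u v -> u != v.
Proof. by apply: contraTneq => ->; rewrite e_irr. Qed.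

Lemma trans_arc (X : {set T}) : trans X ->
  {in X & & , forall x y z, e x y -> e y z -> e x z}.
Proof.
move=> /transP h x y z xX yX zX xy yz; apply: arc_total; last exact: h xy yz.
by apply: contraTneq xy => <-; apply: arc_asym.
Qed.

Lemma trans_small (X : {set T}) : #|X| <= 2 -> trans X.
Proof.
move=> X2; apply/transP => x y z xX yX zX xy yz; apply/negP => zx.
suff: 2 < #|X| by rewrite ltnNge X2.
have : [set x; y; z] \subset X.
  by apply/subsetP => w; rewrite !inE => /orP[/orP[]|] /eqP->.
move/subset_leq_card; apply: leq_trans; rewrite -setUA !cardsU1 cards1 !inE.
by rewrite negb_or (arc_neq xy) (arc_neq yz) eq_sym (arc_neq zx).
Qed.

Lemma trans_join (X Y : {set T}) :
  trans X -> trans Y -> complete X Y -> trans (X :|: Y).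
Proof.
move=> /transP tX /transP tY XY.
have nYX x y : x \in X -> y \in Y -> ~~ e y x.
  by move=> xX yY; apply: arc_asym; apply: XY.
apply/transP => x y z; rewrite !inE.
move=> /orP[xX|xY] /orP[yX|yY] /orP[zX|zY] xy yz.
- exact: tX xy yz.
- exact: nYX.
- by move: yz; rewrite (negbTE (nYX _ _ zX yY)).
- exact: nYX.
- by move: xy; rewrite (negbTE (nYX _ _ yX xY)).
- by move: xy; rewrite (negbTE (nYX _ _ yX xY)).
- by move: yz; rewrite (negbTE (nYX _ _ zX yY)).
- exact: tY xy yz.
Qed.

Lemma complete_disjoint (X Y : {set T}) : complete X Y -> [disjoint X & Y].
Proof.
move=> XY; apply/pred0P => x /=; apply/negP => /andP[xX xY].
by move: (XY x x xX xY); rewrite e_irr.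
Qed.

(** A largest transitive subset of [Y] can be added to [X]. This gain later contradicts criticality
    when [X] is not too small and [Y] is linear. *)
Lemma tr_join (X Y A : {set T}) : X \subset A -> Y \subset A -> trans X ->
  complete X Y \/ complete Y X -> #|X| + tr Y <= tr A.
Proof.
move=> XA YA tX; have [Z [ZY tZ <-]] := tr_witness Y.
have UA : X :|: Z \subset A by rewrite subUset XA (subset_trans ZY).
move/subsetP: ZY => ZY; case=> h.
  have h' : complete X Z by move=> x y xX /ZY; apply: h.
  have := leq_card_setU X Z; rewrite (complete_disjoint h') => -[_ /eqP<-].
  by apply: leq_tr => //; apply: trans_join.
have h' : complete Z X by move=> x y /ZY xX; apply: h.
have := leq_card_setU X Z.
rewrite disjoint_sym (complete_disjoint h') => -[_ /eqP<-].
by apply: leq_tr => //; rewrite setUC; apply: trans_join.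
Qed.

(** A vertex [s] of largest out-degree within [X] works: an in-neighbour of [s] would, by
    transitivity, beat everything that [s] beats, and [s] as well. *)
Lemma trans_source (X : {set T}) : trans X -> X != set0 ->
  exists2 s, s \in X & complete [set s] (X :\ s).
Proof.
move=> tX /set0Pn[x0 x0X].
have [s sX smax] := @arg_maxnP _ x0 (mem X) 
  (fun s => #|[set x in X | e s x]|) x0X.
have {}sX : s \in X := sX.
exists s => // s' x; rewrite !inE => /eqP-> /andP[xs xX].
apply/negPn/negP => /(arc_total); rewrite eq_sym => /(_ xs) xs'.
have := smax x xX; rewrite /geq /= leqNgt => /negP; apply.
apply: proper_card; apply/properP; split.
  apply/subsetP => y; rewrite !inE => /andP[yX sy]; rewrite yX /=.
  exact: (trans_arc tX) sy.
by exists s; rewrite inE ?e_irr ?andbF ?sX ?xs'.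
Qed.

Lemma trans_initial (X : {set T}) q : trans X -> q <= #|X| ->
  exists I : {set T}, [/\ I \subset X, #|I| = q & complete I (X :\: I)].
Proof.
move=> tX; elim: q => [|q IHq] qX.
  by exists set0; rewrite sub0set cards0; split => // x y; rewrite inE.
have [I [IX Iq cI]] := IHq (ltnW qX).
have tXI : trans (X :\: I) by apply: trans_sub tX; apply: subsetDl.
have [|s] := trans_source tXI.
  by rewrite -card_gt0 cardsDS // subn_gt0 Iq.
rewrite !inE => /andP[sI sX] cs; exists (s |: I); split.
- by rewrite subUset sub1set sX.
- by rewrite cardsU1 sI Iq.
move=> x y; rewrite !inE negb_or => /orP[/eqP->|xI] /andP[/andP[ys yI] yX].
  by apply: cs; rewrite !inE ?eqxx ?ys ?yI.
by apply: cI; rewrite // !inE yI.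
Qed.

Lemma trans_chunks (X : {set T}) h q : trans X -> h * q <= #|X| ->
  exists K : nat -> {set T}, [/\ forall i, i < h -> K i \subset X,
    forall i, i < h -> #|K i| = q &
    forall i j, i < j < h -> complete (K i) (K j)].
Proof.
elim: h X => [|h IHh] X tX hqX.
  by exists (fun=> set0); split => // i j; rewrite andbF.
have [I [IX Iq cI]] := @trans_initial X q tX (leq_trans (leq_addr _ _) hqX).
have [||K [KX Kq cK]] := IHh (X :\: I).
- by apply: trans_sub tX; apply: subsetDl.
- by rewrite cardsDS // Iq; move: hqX; lia.
have KI i : i < h -> K i \subset X :\: I by apply: KX.
exists (fun i => if i is i'.+1 then K i' else I); split => //.
- by case=> [|i] // ih; apply: subset_trans (KI _ ih) (subsetDl _ _).
- by case=> [|i] // ih; apply: Kq.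
case=> [|i] [|j] //= ijh; last exact: cK.
by move=> x y xI /(subsetP (KI _ ijh)); apply: cI.
Qed.

(** The out- or the in-neighbourhood of a vertex [x] contains about half of [A]. The induction
    continues there, and [x] is added to the transitive set found. *)
Lemma tr_log (A : {set T}) k : 2 ^ k <= #|A| -> k < tr A.
Proof.
elim: k A => [|k IHk] A kA.
  have /card_gt0P[x xA] : 0 < #|A| by [].
  rewrite -(cards1 x); apply: leq_tr; rewrite ?sub1set //.
  by apply: trans_small; rewrite cards1.
have /card_gt0P[x xA] : 0 < #|A| by apply: leq_trans kA; rewrite expn_gt0.
pose P := [set y in A | e x y]; pose Q := [set y in A | e y x].
have cA : #|A| <= 1 + (#|P| + #|Q|).
  apply: (@leq_trans #|x |: (P :|: Q)|).
    apply: subset_leq_card; apply/subsetP => y yA; rewrite !inE yA /=.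
    have [//|yx] := eqVneq y x.
    by case exy: (e x y) => //=; apply: arc_total; rewrite ?exy // eq_sym.
  apply: leq_trans (leq_card_setU _ _).1 _; rewrite cards1 leq_add2l.
  exact: (leq_card_setU _ _).1.
have tx : trans [set x] by apply: trans_small; rewrite cards1.
have xsub : [set x] \subset A by rewrite sub1set.
have PA : P \subset A by apply/subsetP => y; rewrite inE => /andP[].
have QA : Q \subset A by apply/subsetP => y; rewrite inE => /andP[].
have [kP|kQ] : 2 ^ k <= #|P| \/ 2 ^ k <= #|Q|.
- by apply/orP; move: kA; rewrite expnS; lia.
- have := IHk _ kP; have := @tr_join _ P A xsub PA tx; rewrite cards1.
  suff h : complete [set x] P by move=> /(_ (or_introl h)); lia.
  by move=> y z; rewrite !inE => /eqP-> /andP[].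
have := IHk _ kQ; have := @tr_join _ Q A xsub QA tx; rewrite cards1.
suff h : complete Q [set x] by move=> /(_ (or_intror h)); lia.
by move=> z y; rewrite !inE => /andP[_ zx] /eqP->.
Qed.

End TransitiveSets.

(** * Twin classes of an out-neighbourhood *)

Section TwinClasses.
Variables (T : finType) (e : rel T).
Hypotheses (e_irr : irreflexive e)
           (e_xor : forall u v, u != v -> e u v (+) e v u).

(** To [M :\: W] every vertex of [X] looks like [m]. A cyclic triangle with one vertex in [X] thus
    becomes one of [M] when [m] replaces that vertex, and one with two vertices in [X] would
    contradict homogeneity towards the third. *)
Lemma trans_substitute (M W X : {set T}) m :
  (forall z x x', z \in M :\: W -> x \in W -> x' \in W -> e z x -> e z x') ->
  trans e M -> m \in M :&: W -> trans e X -> X \subset W ->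
  trans e (M :\: W :|: X).
Proof.
move=> homog tM; rewrite inE => /andP[mM mW] tX /subsetP XW.
have homog' z x x' : z \in M :\: W -> x \in W -> x' \in W -> e x z -> e x' z.
  move=> zM xW x'W xz; apply: (arc_total e_xor).
    by move: zM; rewrite inE => /andP[zW _]; apply: contraNneq zW => ->.
  apply: contraTN xz => zx'; apply: (arc_asym e_irr e_xor).
  exact: homog zx'.
have DM z : z \in M :\: W -> z \in M by rewrite inE => /andP[].
apply/transP => x y z; rewrite !(in_setU _ (M :\: W)).
have tM' := elimT (transP e M) tM; have tX' := elimT (transP e X) tX.
case/orP=> [x1|x2] /orP[y1|y2] /orP[z1|z2] xy yz; apply/negP => zx.
- by move: (tM' _ _ _ (DM _ x1) (DM _ y1) (DM _ z1) xy yz); rewrite zx.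
- move: (tM' _ _ _ (DM _ x1) (DM _ y1) mM xy); rewrite (homog y z) ?mW ?XW //.
  by rewrite (homog' x z) ?mW ?XW // => /(_ isT).
- move: (tM' _ _ _ (DM _ x1) mM (DM _ z1)); rewrite (homog x y) ?mW ?XW //.
  by rewrite (homog' z y) ?mW ?XW // => /(_ isT isT); rewrite zx.
- have := homog' _ _ _ x1 (XW _ z2) (XW _ y2) zx.
  by rewrite (negbTE (arc_asym e_irr e_xor xy)).
- move: (tM' _ _ _ mM (DM _ y1) (DM _ z1)); rewrite (homog' y x) ?mW ?XW //.
  by rewrite yz (homog z x) ?mW ?XW // => /(_ isT isT).
- have := homog' _ _ _ y1 (XW _ x2) (XW _ z2) xy.
  by rewrite (negbTE (arc_asym e_irr e_xor yz)).
- have := homog' _ _ _ z1 (XW _ y2) (XW _ x2) yz.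
  by rewrite (negbTE (arc_asym e_irr e_xor zx)).
- by move: (tX' _ _ _ x2 y2 z2 xy yz); rewrite zx.
Qed.

Variables S N : {set T}.
Hypotheses (NS : N \subset S)
  (no_cycle : forall x u v, x \in N -> u \in N -> v \in S :\: N ->
     e x u -> e u v -> ~~ e v x).

(** Classes are indexed by all subsets of [T]; a subset that is the key of no vertex gives an empty
    class, which adds nothing to the sums below. *)
Definition twin_key x := [set v in S :\: N | e v x].
Definition twin_class k := [set x in N | twin_key x == k].

(** If [v] were in the key of [x] but not of [u], then [x], [u], [v] would form a triangle excluded
    by [no_cycle]. So arcs inside [N] go up for inclusion of keys. *)
Lemma twin_key_mono x u : x \in N -> u \in N -> e x u ->
  twin_key x \subset twin_key u.
Proof.
move=> xN uN xu; apply/subsetP => v; rewrite !inE => /andP[/andP[vN vS] vx].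
rewrite vN vS /=; apply: contraTT vx => vu.
apply: (no_cycle xN uN _ xu); first by rewrite inE vN.
by apply: (arc_total e_xor) vu; apply: contraNneq vN => ->.
Qed.

(** For [z] outside [N] the common key decides. For [z] in [N], arcs from [z] to [x] and from [x']
    to [z] would squeeze the key of [z] between two copies of [k], putting [z] in the class. *)
Lemma twin_class_homogeneous k z x x' : z \in S :\: twin_class k ->
  x \in twin_class k -> x' \in twin_class k -> e z x -> e z x'.
Proof.
rewrite !inE => /andP[zk zS] /andP[xN /eqP kx] /andP[x'N /eqP kx'] zx.
have [zN|zN] := boolP (z \in N); last first.
  have : z \in twin_key x by rewrite !inE zN zS.
  by rewrite kx -kx' !inE => /andP[].
rewrite zN /= in zk; apply: contraNT zk => zx'.
have [->|zneq] := eqVneq z x'; first by rewrite kx'.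
rewrite eqEsubset -{1}kx twin_key_mono //= -kx' twin_key_mono //.
exact: (arc_total e_xor).
Qed.

(** Otherwise exchanging [M :&: twin_class k] for a larger transitive subset of [A :&: twin_class k]
    would enlarge the maximum set [M]. *)
Lemma twin_class_exchange k (M A : {set T}) : A \subset S -> M \subset A -> trans e M ->
  #|M| = tr e A -> M :&: twin_class k != set0 ->
  tr e (A :&: twin_class k) <= #|M :&: twin_class k|.
Proof.
move=> AS MA tM Mmax /set0Pn[m mMk].
have [X [XA tX <-]] := tr_witness e (A :&: twin_class k).
have XW : X \subset twin_class k := subset_trans XA (subsetIr _ _).
have homog z x x' : z \in M :\: twin_class k -> x \in twin_class k ->
    x' \in twin_class k -> e z x -> e z x'.
  rewrite inE => /andP[zk zM]; apply: twin_class_homogeneous.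
  by rewrite inE zk (subsetP AS) // (subsetP MA).
have tM' := trans_substitute homog tM mMk tX XW.
have sub : M :\: twin_class k :|: X \subset A.
  rewrite subUset (subset_trans (subsetDl _ _) MA).
  exact: subset_trans XA (subsetIl _ _).
have := leq_tr sub tM'; rewrite -Mmax -(cardsID (twin_class k) M) cardsU.
suff -> : (M :\: twin_class k) :&: X = set0 by rewrite cards0; lia.
apply/setP => z; rewrite !inE; apply/negP => /andP[/andP[zk _]].
by move/(subsetP XW); rewrite inE (negbTE zk).
Qed.

(** The union of largest transitive subsets of the classes is transitive: around a cyclic triangle
    keys increase, so they are equal and the triangle lies in one class. *)
Lemma sum_tr_twin_class : \sum_k tr e (twin_class k) <= tr e N.
Proof.
have [M hM] := fin_all_exists (fun k => tr_witness e (twin_class k)).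
have kM k x : x \in M k -> x \in N /\ twin_key x = k.
  by case: (hM k) => /subsetP h _ _ /h; rewrite inE => /andP[xN /eqP].
pose U := [set x | x \in M (twin_key x)].
have -> : \sum_k tr e (twin_class k) = #|U|.
  under eq_bigr => k _ do case: (hM k) => _ _ <-.
  rewrite -sum1_card; under eq_bigr => k _ do rewrite -sum1_card big_mkcond.
  rewrite exchange_big /= [RHS]big_mkcond /=; apply: eq_bigr => x _.
  rewrite (bigD1 (twin_key x)) //= inE big1 ?addn0 // => k /negP kx.
  by case: ifP => // /kM[_ xk]; case: kx; rewrite xk.
apply: leq_tr; first by apply/subsetP => x; rewrite inE => /kM[].
apply/transP => x y z; rewrite !inE => xM yM zM xy yz; apply/negP => zx.
have [[[xN _] [yN _]] [zN _]] := (kM _ _ xM, kM _ _ yM, kM _ _ zM).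
have sxy := twin_key_mono xN yN xy; have syz := twin_key_mono yN zN yz.
have szx := twin_key_mono zN xN zx.
have exy : twin_key x = twin_key y.
  by apply/eqP; rewrite eqEsubset sxy (subset_trans syz szx).
have eyz : twin_key y = twin_key z.
  by apply/eqP; rewrite eqEsubset syz (subset_trans szx sxy).
have [_ tM _] := hM (twin_key z).
have := elimT (transP e _) tM x y z.
rewrite -{1}eyz -{1}exy -{1}eyz => /(_ xM yM zM xy yz).
by rewrite zx.
Qed.

End TwinClasses.

(** * Sequences of sets with few backward arcs *)

Lemma leq_double_mul_divn a h : 0 < h <= a -> a <= 2 * h * (a %/ h).
Proof.
case/andP=> h0 ha; have q0 : 0 < a %/ h by rewrite divn_gt0.
rewrite -mulnA mul2n -addnn {1}(divn_eq a h) mulnC leq_add2l.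
by apply: leq_trans (ltnW (ltn_pmod _ h0)) _; rewrite leq_pmulr.
Qed.

Section Counting.
Variable T : finType.

Lemma pigeonhole_cover (I : finType) (J : {set I}) (A : {set T})
    (B : I -> {set T}) h : 0 < #|A| -> #|J| <= h ->
  (forall x, x \in A -> exists2 j, j \in J & x \in B j) ->
  exists2 j, j \in J & #|A| <= h * #|B j|.
Proof.
move=> A0 Jh cov; have [/exists_inP[j jJ hj]|] :=
  boolP [exists j in J, #|A| <= h * #|B j|]; first by exists j.
rewrite negb_exists_in => /forall_inP small.
have cA : #|A| <= \sum_(j in J) #|B j|.
  apply: leq_trans (_ : \sum_(x in A) \sum_(j in J) (x \in B j) <= _).
    rewrite -sum1_card; apply: leq_sum => x /cov[j jJ xj].
    by rewrite (bigD1 j) //= xj.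
  rewrite exchange_big; apply: leq_sum => j jJ.
  rewrite -sum1_card big_mkcond [leqRHS]big_mkcond /=; apply: leq_sum => x _.
  by case: (x \in A); case: (x \in B j).
have hB : \sum_(j in J) h * #|B j| <= #|J| * #|A|.-1.
  rewrite -sum_nat_const; apply: leq_sum => j /small; rewrite -ltnNge => hj.
  by rewrite -ltnS prednK.
have : h * #|A| <= h * #|A|.-1.
  apply: leq_trans (_ : h * \sum_(j in J) #|B j| <= _).
    by rewrite leq_mul2l cA orbT.
  by rewrite big_distrr /=; apply: leq_trans hB _; rewrite leq_mul2r Jh orbT.
have J0 : 0 < h.
  have /card_gt0P[x /cov[j jJ _]] := A0.
  by apply: leq_trans Jh; apply/card_gt0P; exists j.
by rewrite leq_mul2l; move: A0 J0; clear; lia.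
Qed.

Lemma markov_count (A : {set T}) (b : T -> nat) c L q : 0 < q ->
  c * L * \sum_(x in A) b x <= #|A| * q ->
  c * #|[set x in A | q < L * b x]| <= #|A|.
Proof.
move=> q0 h; rewrite -(leq_pmul2r q0); apply: leq_trans h.
rewrite -!mulnA leq_mul2l; apply/orP; right.
rewrite -sum_nat_const big_distrr /= [leqRHS]big_mkcond [leqLHS]big_mkcond /=.
apply: leq_sum => x _; rewrite inE; case: (x \in A) => //=.
by case: ltnP => // /ltnW.
Qed.

Lemma disjoint_chunks (A : {set T}) h q : h * q <= #|A| ->
  exists K : nat -> {set T}, [/\ forall i, i < h -> K i \subset A,
    forall i, i < h -> #|K i| = q &
    forall i j, i < h -> j < h -> i != j -> [disjoint K i & K j]].
Proof.
elim: h A => [|h IHh] A hA; first by exists (fun=> set0); split.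
have /card_geqP[s [us sq sA]] : q <= #|A| by apply: leq_trans hA; apply: leq_addr.
pose B := [set x in s].
have BA : B \subset A by apply/subsetP => x; rewrite inE => /sA.
have Bq : #|B| = q by rewrite cardsE -sq; apply/card_uniqP.
have [|K [KA Kq Kd]] := IHh (A :\: B).
  by rewrite cardsDS // Bq; move: hA; rewrite mulSn; lia.
have BK i : i < h -> [disjoint B & K i].
  move=> ih; rewrite disjoint_sym; apply: disjointWl (KA _ ih) _.
  rewrite -setI_eq0; apply/eqP/setP => x; rewrite !inE.
  by case: (x \in s); rewrite ?andbF.
exists (fun i => if i is i'.+1 then K i' else B); split.
- by case=> [|i] // ih; apply: subset_trans (KA _ ih) (subsetDl _ _).
- by case=> [|i] // ih; apply: Kq.
- case=> [|i] [|j] //= ih jh ij; [exact: BK| |exact: Kd].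
  by rewrite disjoint_sym; apply: BK.
Qed.

End Counting.

Section DensePairs.
Variables (T : finType) (e : rel T).
Hypotheses (e_irr : irreflexive e)
           (e_xor : forall u v, u != v -> e u v (+) e v u).

(** For disjoint [P] and [Q] this is the number of arcs from [Q] to [P]. *)
Definition back (P Q : {set T}) := \sum_(p in P) #|[set q in Q | ~~ e p q]|.

Lemma back_exchange (P Q : {set T}) :
  back P Q = \sum_(q in Q) #|[set p in P | ~~ e p q]|.
Proof.
have cE (A : {set T}) (r : pred T) : #|[set x in A | r x]| = \sum_(x in A) r x.
  rewrite -sum1_card big_mkcond [RHS]big_mkcond; apply: eq_bigr => x _.
  by rewrite inE; case: (x \in A) => //=; case: (r x).
rewrite /back; under eq_bigr => p _ do rewrite cE.
by rewrite exchange_big; apply: eq_bigr => q _; rewrite cE.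
Qed.

Lemma back_sub (P P' Q Q' : {set T}) : P' \subset P -> Q' \subset Q ->
  back P' Q' <= back P Q.
Proof.
move=> /subsetP PP /subsetP QQ; rewrite /back [leqRHS]big_mkcond [leqLHS]big_mkcond /=.
apply: leq_sum => p _; case: ifP => // /PP ->; apply: subset_leq_card.
by apply/subsetP => q; rewrite !inE => /andP[/QQ ->].
Qed.

Variables (H : finType) (a : rel H).
Hypotheses (a_irr : irreflexive a)
           (a_xor : forall u v, u != v -> a u v (+) a v u).

Definition embeds : Prop := exists f : H -> T, forall i j, a i j -> e (f i) (f j).

(** Induction on the number of vertices still to embed. If some [x] in [V u] leaves a fraction
    [1 / L] of every other [V j] usable, [u] is placed at [x] and the [V j] shrink, at the cost of a
    factor [L] in [c]. Otherwise each [x] is poor towards some [j], and by pigeonhole one [j] serves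
    for a fraction [1 / #|H|] of [V u]. *)
Lemma greedy_dense_pair (t0 : T) L m c N (U : {set H}) (V : H -> {set T}) :
  0 < N -> 0 < L -> #|U| = m -> (forall i, i \in U -> N <= c * #|V i|) ->
  {in U &, forall i j, i != j -> [disjoint V i & V j]} ->
  ~ (exists2 f : H -> T, {in U, forall i, f i \in V i} &
       {in U &, forall i j, a i j -> e (f i) (f j)}) ->
  exists i j (P Q : {set T}), [/\ i \in U /\ j \in U, P \subset V i /\ Q \subset V j,
    [disjoint P & Q], N <= c * #|H| * L ^ m * #|P| /\ N <= c * #|H| * L ^ m * #|Q|
    & L * back P Q <= #|P| * #|Q|].
Proof.
move=> N0 L0; elim: m => [|m IHm] in c U V *.
  move=> /eqP; rewrite cards_eq0 => /eqP-> _ _ [].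
  by exists (fun=> t0) => i; rewrite inE.
move=> Um NV dV noemb.
have /card_gt0P[u uU] : 0 < #|U| by rewrite Um.
have U'm : #|U :\ u| = m by move: (cardsD1 u U); rewrite uU Um => -[].
pose Nb x j := [set w in V j | if a u j then e x w else e w x].
have NbV x j : Nb x j \subset V j by apply/subsetP => w; rewrite inE => /andP[].
have [/exists_inP[x xV /forall_inP rich]|] :=
    boolP [exists x in V u, [forall j in U :\ u, #|V j| <= L * #|Nb x j|]].
  have [|||] := IHm (c * L) (U :\ u) (Nb x) U'm.
  - move=> j jU; apply: leq_trans (NV j _) _; first by move: jU; rewrite inE => /andP[].
    by rewrite -mulnA leq_mul2l rich ?orbT.
  - move=> i j; rewrite !inE => /andP[_ iU] /andP[_ jU] ij.
    apply: disjointWl (NbV x i) _; apply: disjointWr (NbV x j) _; exact: dV.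
  - case=> f fV fa; apply: noemb; exists (fun i => if i == u then x else f i).
      move=> i iU; case: eqVneq => [->//|iu].
      by apply: (subsetP (NbV x i)); apply: fV; rewrite !inE iu.
    move=> i j iU jU; case: (eqVneq i u) => [->|iu]; case: (eqVneq j u) => [->|ju].
    + by rewrite a_irr.
    + have : f j \in Nb x j by apply: fV; rewrite !inE ju.
      by rewrite inE => /andP[_ h] auj; rewrite auj in h.
    + have : f i \in Nb x i by apply: fV; rewrite !inE iu.
      rewrite inE => /andP[_ h] aiu.
      by move: h; rewrite (negbTE (arc_asym a_irr a_xor aiu)).
    + by apply: fa; rewrite !inE ?iu ?ju.
  move=> i [j [P [Q [[iU jU] [PV QV] PQ [NP NQ] bPQ]]]].
  exists i, j, P, Q; split => //.
  - by move: iU jU; rewrite !inE => /andP[_ ->] /andP[_ ->].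
  - by split; [apply: subset_trans PV _|apply: subset_trans QV _].
  by rewrite expnS mulnA -(mulnA c) (mulnC #|H|) mulnA.
rewrite negb_exists_in => /forall_inP poor.
have Vu0 : 0 < #|V u|.
  by have := NV u uU; case: #|V u| => //; rewrite muln0; move: N0; clear; case: N.
pose X j := [set x in V u | #|V j| > L * #|Nb x j|].
have [j jU Xj] : exists2 j, j \in U :\ u & #|V u| <= #|H| * #|X j|.
  apply: pigeonhole_cover => //; first exact: max_card.
  move=> x xV; have := poor x xV; rewrite negb_forall_in => /exists_inP[j jU].
  by rewrite -ltnNge => h; exists j => //; rewrite inE xV.
have {jU} [ju jU] : j != u /\ j \in U by move: jU; rewrite !inE => /andP[].
have XV : X j \subset V u by apply/subsetP => x; rewrite inE => /andP[].
have dX : [disjoint X j & V j].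
  by apply: disjointWl XV _; apply: dV => //; rewrite eq_sym.
have neq x w : x \in X j -> w \in V j -> x != w.
  by move=> xX wV; apply: contraTneq xX => ->; rewrite (disjointFl dX).
have few (b : T -> nat) : (forall x, x \in X j -> b x <= #|Nb x j|) ->
    L * \sum_(x in X j) b x <= #|X j| * #|V j|.
  move=> hb; rewrite big_distrr /= -sum_nat_const; apply: leq_sum => x xX.
  apply: leq_trans (_ : L * #|Nb x j| <= _); first by rewrite leq_mul2l hb ?orbT.
  by move: xX; rewrite inE => /andP[_ /ltnW].
have Lm : 0 < L ^ m.+1 by rewrite expn_gt0 L0.
have sizeX : N <= c * #|H| * L ^ m.+1 * #|X j|.
  apply: leq_trans (NV u uU) _; rewrite -!mulnA leq_mul2l; apply/orP; right.
  by apply: leq_trans Xj _; rewrite leq_mul2l leq_pmull ?orbT.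
have H0 : 0 < #|H| by apply/card_gt0P; exists u.
have sizeV : N <= c * #|H| * L ^ m.+1 * #|V j|.
  apply: leq_trans (NV j jU) _; rewrite -!mulnA leq_mul2l; apply/orP; right.
  by rewrite mulnA leq_pmull // muln_gt0 H0.
(* Nearly all arcs between [X j] and [V j] oppose the arc between [u] and [j], whose direction
   therefore fixes the order of the pair. *)
have [auj|auj] := boolP (a u j).
- exists j, u, (V j), (X j); split => //; first by rewrite disjoint_sym.
  rewrite back_exchange [leqRHS]mulnC; apply: few => x xX; apply: subset_leq_card.
  apply/subsetP => w; rewrite !inE auj => /andP[wV wx]; rewrite wV /=.
  by apply: (arc_total e_xor) wx; rewrite eq_sym neq.
- exists u, j, (X j), (V j); split => //.
  apply: few => x xX; apply: subset_leq_card.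
  apply/subsetP => w; rewrite !inE (negbTE auj) => /andP[wV xw]; rewrite wV /=.
  by apply: (arc_total e_xor) xw; rewrite neq.
Qed.

End DensePairs.

Lemma dense_pair (H : finType) (a : rel H) L :
  irreflexive a -> (forall u v, u != v -> a u v (+) a v u) -> 0 < L ->
  exists2 D, 0 < D & forall (T : finType) (e : rel T), irreflexive e ->
    (forall u v, u != v -> e u v (+) e v u) -> ~ embeds e a ->
    forall A : {set T}, D <= #|A| ->
    exists P Q : {set T}, [/\ P \subset A, Q \subset A, [disjoint P & Q],
      #|A| <= D * #|P| /\ #|A| <= D * #|Q| & L * back e P Q <= #|P| * #|Q|].
Proof.
move=> a_irr a_xor L0; set h := #|H|.
(* The factor [2 * h] pays for cutting [A] into [h] equal parts and [h * L ^ h] for the greedy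
   embedding. *)
exists (2 * h * h * L ^ h).+1 => // T e e_irr e_xor noemb A DA.
have A0 : 0 < #|A| by apply: leq_trans DA.
have /card_gt0P[t0 _] := A0.
have h0 : 0 < h.
  rewrite lt0n; apply/negP => /eqP/card0_eq H0; apply: noemb.
  by exists (fun=> t0) => i; have := H0 i; rewrite inE.
have hA : h <= #|A|.
  apply: leq_trans DA; apply: leqW; rewrite -!mulnA mulnC -!mulnA leq_pmulr //.
  by rewrite !muln_gt0 h0 expn_gt0 L0.
pose q := #|A| %/ h.
have Aq : #|A| <= 2 * h * q by apply: leq_double_mul_divn; rewrite h0.
have [|K [KA Kq Kd]] := @disjoint_chunks _ A h q.
  by rewrite mulnC; apply: leq_trunc_div.
pose V (i : H) := K (enum_rank i).
have [||||i [j [P [Q [_ [PV QV] PQ [NP NQ] bPQ]]]]] :=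
  @greedy_dense_pair T e e_xor H a a_irr a_xor t0 L h (2 * h) #|A| [set: H] V A0 L0.
- exact: cardsT.
- by move=> i _; rewrite /V Kq.
- move=> i j _ _ ij; apply: Kd => //; apply: contraNneq ij => ij.
  by apply/eqP/enum_rank_inj/val_inj.
- case=> f _ fa; apply: noemb; exists f => i j; apply: fa; exact: in_setT.
exists P, Q; split => //.
- by apply: subset_trans PV (KA _ _).
- by apply: subset_trans QV (KA _ _).
- by split; [apply: leq_trans NP _|apply: leq_trans NQ _]; rewrite leq_mul2r leqnSn orbT.
Qed.

(** Doubling: each half of the sequence is found inside one side of a dense pair. *)
Lemma dense_sequence (H : finType) (a : rel H) k L :
  irreflexive a -> (forall u v, u != v -> a u v (+) a v u) -> 0 < L ->
  exists2 D, 0 < D & forall (T : finType) (e : rel T), irreflexive e ->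
    (forall u v, u != v -> e u v (+) e v u) -> ~ embeds e a ->
    forall A : {set T}, D <= #|A| ->
    exists B : nat -> {set T},
      (forall i, i < 2 ^ k -> B i \subset A /\ #|A| <= D * #|B i|) /\
      (forall i j, i < j < 2 ^ k -> [disjoint B i & B j] /\
         L * back e (B i) (B j) <= #|B i| * #|B j|).
Proof.
move=> a_irr a_xor; elim: k => [|k IHk] in L * => L0.
  exists 1 => // T e _ _ _ A _; exists (fun=> A).
  split=> [i|i j]; first by rewrite mul1n.
  by case/andP=> ij; rewrite expn0 ltnS leqn0 => /eqP j0; rewrite j0 in ij.
have [D1 D1_gt0 hD1] := IHk L L0.
(* Passing to parts of relative size [1 / D1] on both sides may multiply the density of backward
   arcs by [D1 * D1]. *)
have L'0 : 0 < L * (D1 * D1) by rewrite !muln_gt0 L0 D1_gt0.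
have [D2 D2_gt0 hD2] := dense_pair a_irr a_xor L'0.
exists (D2 * D1); first by rewrite muln_gt0 D2_gt0.
move=> T e e_irr e_xor noemb A DA.
have D2A : D2 <= #|A| by apply: leq_trans DA; rewrite leq_pmulr.
have [P [Q [PA QA PQ [AP AQ] bPQ]]] := hD2 T e e_irr e_xor noemb A D2A.
have big (X : {set T}) : #|A| <= D2 * #|X| -> D1 <= #|X|.
  by move=> AX; rewrite -(leq_pmul2l D2_gt0); apply: leq_trans AX.
have [B1 [sB1 dB1]] := hD1 T e e_irr e_xor noemb P (big P AP).
have [B2 [sB2 dB2]] := hD1 T e e_irr e_xor noemb Q (big Q AQ).
pose m := 2 ^ k; have mm : 2 ^ k.+1 = m + m by rewrite expnS mul2n addnn.
have sz (X Y : {set T}) : #|A| <= D2 * #|X| -> #|X| <= D1 * #|Y| ->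
    #|A| <= D2 * D1 * #|Y|.
  by move=> AX XY; apply: leq_trans AX _; rewrite -mulnA leq_mul2l XY orbT.
have sub i : m <= i -> i < m + m -> i - m < m by clear; lia.
exists (fun i => if i < m then B1 i else B2 (i - m)); rewrite mm; split.
  move=> i im; case: ltnP => mi.
    have [BP PB] := sB1 i mi; split; first exact: subset_trans BP PA.
    exact: sz AP PB.
  have [BQ QB] := sB2 _ (sub i mi im); split; first exact: subset_trans BQ QA.
  exact: sz AQ QB.
move=> i j /andP[ij jm]; case: (ltnP i m) => im; case: (ltnP j m) => mj.
- by apply: dB1; rewrite ij.
- have [BP PB] := sB1 i im; have [BQ QB] := sB2 _ (sub j mj jm).
  split; first by apply: disjointWl BP _; apply: disjointWr BQ _.
  have D0 : 0 < D1 * D1 by rewrite muln_gt0 D1_gt0.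
  rewrite -(leq_pmul2r D0) mulnAC.
  apply: leq_trans (leq_mul (leqnn _) (back_sub e BP BQ)) _.
  apply: leq_trans bPQ _; apply: leq_trans (leq_mul PB QB) _.
  by rewrite mulnACA mulnC.
- by move: im; rewrite leqNgt (ltn_trans ij mj).
- apply: dB2; apply/andP; split; last exact: sub.
  by apply: ltn_sub2r => //; apply: leq_ltn_trans im ij.
Qed.

(** * Pointwise bounds on backward arcs, and transitive sets at even indices *)

Section SmoothStructures.
Variables (T : finType) (e : rel T).
Hypotheses (e_irr : irreflexive e)
           (e_xor : forall u v, u != v -> e u v (+) e v u).

(** [b] tells whether the set of [x] comes before the set of [y], so that both sides of a pair are
    handled by one formula. *)
Definition forward (b : bool) x y := if b then e x y else e y x.
Definition defect (b : bool) x (Q : {set T}) :=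
  #|[set y in Q | ~~ forward b x y]|.

Lemma defect_sub b x (Q Q' : {set T}) : Q' \subset Q -> defect b x Q' <= defect b x Q.
Proof.
move=> /subsetP QQ; apply: subset_leq_card; apply/subsetP => y.
by rewrite !inE => /andP[/QQ->].
Qed.

Lemma sum_defect b (P Q : {set T}) :
  \sum_(x in P) defect b x Q = if b then back e P Q else back e Q P.
Proof. by case: b => //; rewrite back_exchange. Qed.

Lemma sum_defect_exchange b (P Q : {set T}) :
  \sum_(x in P) defect b x Q = \sum_(y in Q) defect (~~ b) y P.
Proof. by rewrite !sum_defect; case: b. Qed.

(** The pointwise counterpart of a bound on [back], which controls only averages. *)
Definition smooth m L (B : nat -> {set T}) : Prop :=
  forall i j, i < m -> j < m -> i != j ->
    [disjoint B i & B j] /\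
    {in B i, forall x, L * defect (i < j) x (B j) <= #|B j|}.

(** By Markov's inequality each [j] spoils at most a fraction [1 / (2 * m)] of [B i], so half of
    [B i] survives. The factor 2 in [2 * L] makes up for the halving of [B j]. *)
Lemma smoothing m L (B : nat -> {set T}) : 0 < m ->
  (forall i, i < m -> 0 < #|B i|) ->
  (forall i j, i < j < m -> [disjoint B i & B j] /\
     2 * m * (2 * L) * back e (B i) (B j) <= #|B i| * #|B j|) ->
  exists B' : nat -> {set T}, smooth m L B' /\
    forall i, i < m -> B' i \subset B i /\ #|B i| <= 2 * #|B' i|.
Proof.
move=> m0 B0 hB.
pose bad i j := [set x in B i | #|B j| < 2 * L * defect (i < j) x (B j)].
have badm i j : i < m -> j < m -> i != j -> 2 * m * #|bad i j| <= #|B i|.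
  move=> im jm ij; apply: markov_count; first exact: B0.
  rewrite sum_defect; case: ltnP => [ij'|ji].
    by have [|_] := hB i j; first by rewrite ij'.
  have ji' : j < i by rewrite ltn_neqAle ji eq_sym ij.
  by have [|_] := hB j i; [rewrite ji'|rewrite [leqRHS]mulnC].
pose B' i := [set x in B i | [forall j : 'I_m, (i != j) ==> (x \notin bad i j)]].
have B'B i : B' i \subset B i by apply/subsetP => x; rewrite inE => /andP[].
have B'2 i : i < m -> #|B i| <= 2 * #|B' i|.
  move=> im.
  have : m * (2 * #|B i :\: B' i|) <= m * #|B i|.
    apply: leq_trans (_ : \sum_(j < m | i != j) 2 * m * #|bad i j| <= _).
      rewrite -big_distrr /= mulnCA mulnA leq_mul2l; apply/orP; right.
      rewrite -sum1_card.
      apply: leq_trans (_ : \sum_(x in B i) \sum_(j < m | i != j) (x \in bad i j) <= _).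
        rewrite [leqLHS]big_mkcond [leqRHS]big_mkcond /=; apply: leq_sum => x _.
        rewrite !inE; case xB: (x \in B i); rewrite ?andbF //= andbT.
        case: ifP => //; rewrite negb_forall => /existsP[j].
        rewrite negb_imply negbK => /andP[ij xj].
        by rewrite (bigD1 j) //= xj.
      rewrite exchange_big; apply: leq_sum => j _.
      rewrite -sum1_card [leqLHS]big_mkcond [leqRHS]big_mkcond /=; apply: leq_sum => x _.
      by case: (x \in B i); case: (x \in bad i j).
    rewrite -[X in _ <= X * _]card_ord -sum_nat_const [leqLHS]big_mkcond /=.
    by apply: leq_sum => j _; case: ifP => // ij; apply: badm.
  rewrite leq_pmul2l // cardsDS //; have := subset_leq_card (B'B i).
  by clear; lia.
exists B'; split=> [i j im jm ij|i im]; last by split; [exact: B'B|exact: B'2].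
split.
  apply: disjointWl (B'B i) _; apply: disjointWr (B'B j) _.
  case: (ltnP i j) => ij'; first by have [|] := hB i j; first by rewrite ij'.
  have ji' : j < i by rewrite ltn_neqAle ij' eq_sym ij.
  by rewrite disjoint_sym; have [|] := hB j i; first by rewrite ji'.
move=> x; rewrite inE => /andP[xB /forallP/(_ (Ordinal jm))/=].
rewrite ij inE xB /= -leqNgt => h.
have := leq_mul (leqnn L) (defect_sub (i < j) x (B'B j)).
by have := B'2 j jm; move: h; rewrite -mulnA; clear; lia.
Qed.

(* The sets of even index below [s] are made transitive one at a time. Passing
   to a transitive subset [X] spoils the smoothness of the other sets towards
   [X] only, and is repaired by keeping the better half of each of them. *)
Lemma mixing (V : {set T}) t n m L D (C0 : nat -> {set T}) s :
  0 < D -> 0 < t ->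
  (forall (D' : nat) (A : {set T}), A \subset V -> n <= D' * #|A| ->
     exists X : {set T}, [/\ X \subset A, trans e X & t <= 2 * D' * #|X|]) ->
  0 < n -> s <= m -> smooth m (2 ^ s * L) C0 ->
  (forall i, i < m -> C0 i \subset V /\ n <= D * #|C0 i|) ->
  exists C : nat -> {set T}, smooth m L C /\
    forall i, i < m -> C i \subset V /\
      if (i < s) && ~~ odd i then trans e (C i) /\ t <= 2 ^ s * D * #|C i|
      else n <= 2 ^ s * D * #|C i|.
Proof.
move=> D0 t0 ht n0; elim: s => [|s IHs] in L * => sm smC0 hC0.
  exists C0; split; first by rewrite expn0 mul1n in smC0.
  by move=> i im; rewrite ltn0 /= expn0 mul1n; apply: hC0.
(* The earlier stage is asked for smoothness [2 * L], because this one may halve the sets. *)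
have [C [smC hC]] : exists C : nat -> {set T}, smooth m (2 * L) C /\
    forall i, i < m -> C i \subset V /\
      if (i < s) && ~~ odd i then trans e (C i) /\ t <= 2 ^ s * D * #|C i|
      else n <= 2 ^ s * D * #|C i|.
  by apply: IHs => //; [exact: ltnW|rewrite mulnA -expnSr].
have grow u A : u <= 2 ^ s * D * A -> u <= 2 ^ s.+1 * D * A.
  move=> h; apply: leq_trans h _.
  by rewrite expnS -[2 * _ * D]mulnA -[leqRHS]mulnA leq_pmull.
have [os|es] := boolP (odd s).
  exists C; split=> [i j im jm ij|i im].
    have [dC sC] := smC i j im jm ij; split => // x xC.
    by apply: leq_trans (sC x xC); rewrite -mulnA leq_pmull.
  have [CV hCi] := hC i im; split => //; move: hCi.
  have -> : (i < s.+1) && ~~ odd i = (i < s) && ~~ odd i.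
    by rewrite ltnS leq_eqVlt; case: eqVneq => // ->; rewrite os ltnn.
  case: ifP => _ h; last exact: grow.
  by case: h => tC h; split => //; apply: grow.
have [CsV] := hC s sm; rewrite ltnn /= => nCs.
have [X [XC tX tleX]] := ht _ _ CsV nCs.
have X0 : 0 < #|X|.
  by rewrite lt0n; apply: contraTneq tleX => ->; rewrite muln0 -ltnNge.
pose C' j := if j == s then X
             else [set v in C j | L * defect (j < s) v X <= #|X|].
have C's : C' s = X by rewrite /C' eqxx.
have C'C j : C' j \subset C j.
  by rewrite /C'; case: eqP => [->//|_]; apply/subsetP => v; rewrite inE => /andP[].
have C'2 j : j < m -> j != s -> #|C j| <= 2 * #|C' j|.
  move=> jm js.
  (* Vertices of [X] are smooth towards [C j]. Counting the same pairs from the side of [C j] bounds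
     the average defect towards [X], and Markov's inequality keeps half of [C j]. *)
  have hsum : 2 * L * \sum_(x in C j) defect (j < s) x X <= #|C j| * #|X|.
    rewrite sum_defect_exchange big_distrr [leqRHS]mulnC -sum_nat_const.
    apply: leq_sum => x /(subsetP XC) xC.
    have [|_ h] := smC s j sm jm; first by rewrite eq_sym.
    have -> : ~~ (j < s) = (s < j).
      by rewrite -leqNgt leq_eqVlt eq_sym (negbTE js).
    exact: h.
  have := markov_count X0 hsum; have := subset_leq_card (C'C j).
  have -> : [set v in C j | #|X| < L * defect (j < s) v X] = C j :\: C' j.
    apply/setP => v; rewrite /C' (negbTE js) !inE; case: (v \in C j) => //=.
    by rewrite andbT ltnNge.
  by rewrite cardsDS //; clear; lia.
exists C'; split=> [i j im jm ij|i im].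
  have [dC sC] := smC i j im jm ij; split.
    by apply: disjointWl (C'C i) _; apply: disjointWr (C'C j) _.
  have [js|js] := eqVneq j s.
    move=> x; rewrite js C's {1}/C'; case: eqP => [is_s|_].
      by rewrite is_s js eqxx in ij.
    by rewrite inE => /andP[].
  move=> x /(subsetP (C'C i)) xC.
  have := sC x xC; have := C'2 j jm js.
  have := leq_mul (leqnn L) (defect_sub (i < j) x (C'C j)).
  by rewrite -mulnA; clear; lia.
have [CV hCi] := hC i im; split; first exact: subset_trans (C'C i) CV.
have [->|i_s] := eqVneq i s.
  by rewrite ltnSn es C's; split => //; rewrite expnS -!mulnA in tleX *.
have -> : (i < s.+1) && ~~ odd i = (i < s) && ~~ odd i.
  by rewrite ltnS leq_eqVlt (negbTE i_s).
have dbl u : u <= 2 ^ s * D * #|C i| -> u <= 2 ^ s.+1 * D * #|C' i|.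
  move=> h; apply: leq_trans h _; rewrite expnS -!mulnA [leqRHS]mulnCA leq_mul2l.
  by rewrite [2 * (D * _)]mulnCA leq_mul2l C'2 ?orbT.
case: ifP hCi => _; last exact: dbl.
by case=> tC h; split; [apply: trans_sub tC; apply: C'C|apply: dbl].
Qed.

End SmoothStructures.

(** * Embedding the components of the backward graph *)

Section Embedding.
Variables (H : tournament) (theta : H -> 'I_#|H|) (C : {set H}).
Hypotheses (theta_inj : injective theta)
           (H_ord : flotilla_galaxy_ordering theta C).

Local Notation bg := (bgraph theta).

Lemma theta_eq (u v : H) : theta u = theta v :> nat -> u = v.
Proof. by move=> /val_inj/theta_inj. Qed.

Lemma theta_ltNge (u v : H) : u != v -> ~~ (theta u < theta v) -> theta v < theta u.
Proof.
move=> uv; rewrite -leqNgt leq_eqVlt => /orP[/eqP/theta_eq vu|//].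
by rewrite vu eqxx in uv.
Qed.

Lemma bgraph_sym : symmetric bg.
Proof. by move=> u v; rewrite /bgraph orbC. Qed.

Lemma tarc_asym (u v : H) : tarc u v -> ~~ tarc v u.
Proof. exact: (arc_asym (@tarc_irr H) (@tarc_xor H)). Qed.

Lemma bgraph_arc (u v : H) : bg u v -> theta u < theta v -> tarc v u.
Proof.
by rewrite /bgraph /backward => /orP[] /andP[vu h] h'; rewrite ?vu // ltnNge ltnW in h.
Qed.

Lemma not_bgraph_arc (u v : H) : ~~ bg u v -> theta u < theta v -> tarc u v.
Proof.
move=> buv uv; have [//|/(arc_total (@tarc_xor H)) vu] := boolP (tarc u v).
have {}vu : tarc v u by apply: vu; apply: contraTneq uv => ->; rewrite ltnn.
by move: buv; rewrite /bgraph /backward vu uv orbT.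
Qed.

Lemma not_bgraph_lt (u v : H) : ~~ bg u v -> tarc u v -> theta u < theta v.
Proof.
move=> buv uv; have [//|] := boolP (theta u < theta v).
have neq : u != v by apply: contraTneq uv => ->; rewrite tarc_irr.
by move/(theta_ltNge neq) => vu; move: buv; rewrite /bgraph /backward uv vu.
Qed.

Definition component u : {set H} := [set v | connect bg u v].

Lemma component_in u : component u \in bcomponents theta.
Proof. by apply/imsetP; exists u. Qed.

Lemma bgraph_connect_sym : connect_sym bg.
Proof. exact: sym_connect_sym bgraph_sym. Qed.

Lemma bcomponent_closed (S : {set H}) u v : S \in bcomponents theta ->
  bg u v -> (u \in S) = (v \in S).
Proof.
case/imsetP=> w _ -> uv; rewrite !inE.
by rewrite (same_connect_r bgraph_connect_sym (connect1 uv)).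
Qed.

Lemma bcomponent_eq (S S' : {set H}) u : S \in bcomponents theta ->
  S' \in bcomponents theta -> u \in S -> u \in S' -> S = S'.
Proof.
case/imsetP=> w _ -> /imsetP[w' _ ->]; rewrite !inE => wu w'u.
apply/setP => v; rewrite !inE (same_connect bgraph_connect_sym wu).
by rewrite (same_connect bgraph_connect_sym w'u).
Qed.

Variables (T : finType) (e : rel T).
Hypotheses (e_irr : irreflexive e)
           (e_xor : forall u v, u != v -> e u v (+) e v u).

(* The vertices to be placed in a linear set. *)
Definition long_set_vertex i : Prop :=
  (exists S, star_component theta C S i) \/
  (exists S, [/\ S \in bcomponents theta, i \in S &
     left_boat theta S \/ right_boat theta S]).

Variables (V : {set T}) (A : H -> {set T}) (n t D L : nat).
Hypotheses
  (A_V : forall i, A i \subset V)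
  (A_gt0 : forall i, 0 < #|A i|)
  (A_smooth : forall i j, i != j -> [disjoint A i & A j] /\
     {in A i, forall x, L * defect e (theta i < theta j) x (A j) <= #|A j|})
  (A_long : forall i, long_set_vertex i -> n <= D * #|A i|)
  (A_leaf : forall S c, star_component theta C S c -> {in S :\ c, forall i,
     trans e (A i) /\ t <= D * #|A i|})
  (A_leaves : forall S c, star_component theta C S c ->
     {in S :\ c &, forall i j, theta i < theta j -> complete e (A i) (A j)})
  (L_ge : 2 * #|H| + 2 * (64 * 64) <= L)
  (no_complete : forall X Y : {set T}, X \subset V -> Y \subset V -> trans e X ->
     t <= 2 * D * #|X| -> n <= 2 * D * #|H| * #|Y| ->
     complete e X Y \/ complete e Y X -> False)
  (left_boat_ex : forall X W : {set T}, X \subset V -> W \subset V ->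
     [disjoint X & W] -> n <= 2 * D * #|X| -> n <= 2 * D * #|W| ->
     {in W, forall y, 64 * 64 * #|[set x in X | e y x]| <= #|X|} ->
     exists x u v y, [/\ [/\ x \in X, u \in X, v \in X & y \in W],
       [&& e x u, e u v & e v x] & [&& e y x, e y u & e v y]])
  (right_boat_ex : forall X W : {set T}, X \subset V -> W \subset V ->
     [disjoint X & W] -> n <= 2 * D * #|X| -> n <= 2 * D * #|W| ->
     {in W, forall y, 64 * 64 * #|[set x in X | e x y]| <= #|X|} ->
     exists x u v y, [/\ [/\ x \in X, u \in X, v \in X & y \in W],
       [&& e u x, e v u & e x v] & [&& e x y, e u y & e y v]]).

(** By the first clause [Z] is a union of components, so arcs between [Z] and the rest of [H] all go
    forward. The last clause keeps a large part of each remaining [A i] usable. *)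
Definition partial_embedding (Z : {set H}) (f : H -> T) : Prop :=
  [/\ forall u v, bg u v -> (u \in Z) = (v \in Z),
      {in Z &, forall u v, tarc u v -> e (f u) (f v)} &
      forall u i, u \in Z -> i \notin Z ->
        L * defect e (theta u < theta i) (f u) (A i) <= #|A i|].

Section Step.
Variables (Z : {set H}) (f : H -> T).
Hypothesis Zf : partial_embedding Z f.

Definition candidates i :=
  [set w in A i | [forall z in Z, forward e (theta z < theta i) (f z) w]].

Lemma candidates_sub i : candidates i \subset A i.
Proof. by apply/subsetP => w; rewrite inE => /andP[]. Qed.

Lemma candidates_V i : candidates i \subset V.
Proof. exact: subset_trans (candidates_sub i) (A_V i). Qed.

Lemma candidates_disjoint i j : i != j -> [disjoint candidates i & candidates j].
Proof.
move=> /A_smooth[dA _].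
by apply: disjointWl (candidates_sub i) _; apply: disjointWr (candidates_sub j) _.
Qed.

Lemma candidatesP i w z : w \in candidates i -> z \in Z ->
  forward e (theta z < theta i) (f z) w.
Proof. by rewrite inE => /andP[_ /forall_inP]; apply. Qed.

(** At most [#|H|] vertices are placed, and each excludes at most a fraction [1 / (2 * #|H|)] of
    [A i], since [2 * #|H| <= L]. *)
Lemma candidates_card i : i \notin Z -> #|A i| <= 2 * #|candidates i|.
Proof.
move=> iZ; have [_ _ hZ] := Zf.
have H0 : 0 < #|H| by apply/card_gt0P; exists i.
have : #|H| * (2 * #|A i :\: candidates i|) <= #|H| * #|A i|.
  apply: leq_trans (_ : L * #|A i :\: candidates i| <= _).
    by rewrite mulnA [#|H| * 2]mulnC leq_mul2r; apply/orP; right; lia.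
  apply: leq_trans (_ : \sum_(z in Z) L * defect e (theta z < theta i) (f z) (A i) <= _).
    rewrite -big_distrr leq_mul2l; apply/orP; right; rewrite -sum1_card.
    apply: leq_trans (_ : \sum_(w in A i) \sum_(z in Z)
        ~~ forward e (theta z < theta i) (f z) w <= _).
      rewrite [leqLHS]big_mkcond [leqRHS]big_mkcond /=; apply: leq_sum => w _.
      rewrite !inE; case: (w \in A i); rewrite ?andbF //= andbT.
      case: ifP => //; rewrite negb_forall_in => /exists_inP[z zZ hz].
      by rewrite (bigD1 z) //= hz.
    rewrite exchange_big; apply: leq_sum => z _.
    rewrite /defect -sum1_card [leqLHS]big_mkcond [leqRHS]big_mkcond /=.
    apply: leq_sum => w _; rewrite inE.
    by case: (w \in A i) => //=; case: forward.
  apply: leq_trans (_ : \sum_(z in Z) #|A i| <= _).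
    by apply: leq_sum => z zZ; apply: hZ.
  by rewrite sum_nat_const leq_mul2r max_card orbT.
rewrite leq_pmul2l // cardsDS ?candidates_sub //.
by have := subset_leq_card (candidates_sub i); clear; lia.
Qed.

Lemma candidates_large (u : nat) i : i \notin Z -> u <= D * #|A i| ->
  u <= 2 * D * #|candidates i|.
Proof.
move=> iZ h; apply: leq_trans h _.
by rewrite [2 * D]mulnC -mulnA leq_mul2l candidates_card ?orbT.
Qed.

Variable S : {set H}.
Hypotheses (S_comp : S \in bcomponents theta) (SZ : [disjoint S & Z]).

Let S_notin i : i \in S -> i \notin Z.
Proof. by move=> iS; rewrite (disjointFr SZ). Qed.

(* Three consecutive vertices of a boat are all placed in the set of one of
   them, whence [s']. *)
Definition component_embedding (g : H -> T) : Prop :=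
  {in S, forall s, exists s', [/\ s' \in S, g s \in candidates s' &
     forall i, i \notin S -> (theta s < theta i) = (theta s' < theta i)]} /\
  {in S &, forall s s', tarc s s' -> e (g s) (g s')}.

(** No edge of the backward graph joins [Z] to [S], so these arcs go forward in [H]; candidates were
    chosen to have forward arcs with the images of [Z]. *)
Lemma extend_partial_embedding g : component_embedding g ->
  partial_embedding (Z :|: S) (fun i => if i \in S then g i else f i).
Proof.
case=> gpos garc; have [Zcl Zarc Zgood] := Zf.
have SnotZ i : i \in Z -> (i \in S) = false by move=> iZ; rewrite (disjointFl SZ).
have nobg z s : z \in Z -> s \in S -> ~~ bg z s.
  by move=> zZ sS; apply/negP => /Zcl; rewrite zZ => /esym; rewrite (negbTE (S_notin sS)).
split.
- by move=> u v uv; rewrite !inE (Zcl u v uv) (bcomponent_closed S_comp uv).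
- move=> u v; rewrite !inE => /orP[uZ|uS] /orP[vZ|vS] uv.
  + by rewrite !SnotZ //; apply: Zarc.
  + rewrite (SnotZ u) // vS; have ult := not_bgraph_lt (nobg u v uZ vS) uv.
    have [s' [s'S gc hs]] := gpos v vS.
    have := candidatesP gc uZ; rewrite /forward ifT //.
    have neq : s' != u by apply: contraTneq uZ => <-; apply: S_notin.
    apply: theta_ltNge; first by [].
    by rewrite -hs ?SnotZ // -leqNgt ltnW.
  + rewrite (SnotZ v) // uS; have bvu : ~~ bg u v by rewrite bgraph_sym nobg.
    have ult := not_bgraph_lt bvu uv.
    have [s' [s'S gc hs]] := gpos u uS.
    have := candidatesP gc vZ; rewrite /forward ifF //.
    apply/negbTE; rewrite -leqNgt ltnW // -hs ?SnotZ //.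
  + by rewrite uS vS; apply: garc.
- move=> u i; rewrite !inE negb_or => /orP[uZ|uS] /andP[iZ iS].
    by rewrite SnotZ //; apply: Zgood.
  rewrite uS; have [s' [s'S gc hs]] := gpos u uS; rewrite hs //.
  have neq : s' != i by apply: contraNneq iS => <-.
  by have [_ h] := A_smooth neq; apply: h; apply: (subsetP (candidates_sub s')).
Qed.

Lemma singleton_embedding : #|S| = 1 -> exists g, component_embedding g.
Proof.
move=> /eqP/cards1P[u Su]; have uS : u \in S by rewrite Su inE.
have /card_gt0P[w wc] : 0 < #|candidates u|.
  have := candidates_card (S_notin uS); have := A_gt0 u; clear; lia.
exists (fun=> w); split.
  by move=> s; rewrite Su inE => /eqP->; exists u; rewrite inE eqxx.
by move=> s s'; rewrite Su !inE => /eqP-> /eqP->; rewrite tarc_irr.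
Qed.

(** [b] is true when the leaves precede the centre, so that the backward arcs leave the centre. If
    every candidate failed for some leaf, a single leaf would account for a linear set of failures,
    contrary to [no_complete]. *)
Lemma star_center_pick c (b : bool) : star_component theta C S c ->
  exists2 x, x \in candidates c & {in S :\ c, forall l,
    exists2 y, y \in candidates l & forward e b x y}.
Proof.
move=> hS; have [_ Cc hstar] := hS.
have cS : c \in S by have := set11 c; rewrite -Cc inE => /andP[].
have nc : n <= 2 * D * #|candidates c|.
  by apply: candidates_large; [exact: S_notin|apply: A_long; left; exists S].
have [/exists_inP[x xc /forall_inP h]|] := boolP [exists x in candidates c,
    [forall l in S :\ c, [exists y in candidates l, forward e b x y]]].
  by exists x => // l lS; have /exists_inP[y yl xy] := h l lS; exists y.
rewrite negb_exists_in => /forall_inP none; exfalso.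
have [c0|c0] := posnP #|candidates c|.
  have := A_gt0 c; have := candidates_card (S_notin cS); rewrite c0; clear; lia.
pose B l := [set x in candidates c | [forall y in candidates l, ~~ forward e b x y]].
have BC l : B l \subset candidates c by apply/subsetP => x; rewrite inE => /andP[].
have [l lS cB] : exists2 l, l \in S :\ c & #|candidates c| <= #|H| * #|B l|.
  apply: pigeonhole_cover => //; first exact: max_card.
  move=> x xc; have := none x xc; rewrite negb_forall_in => /exists_inP[l lS].
  by rewrite negb_exists_in => h; exists l => //; rewrite inE xc.
have [lc lS'] : l != c /\ l \in S by move: lS; rewrite !inE => /andP[].
have [tA tl] := A_leaf hS lS.
apply: (@no_complete (candidates l) (B l)).
- exact: candidates_V.
- exact: subset_trans (BC l) (candidates_V c).
- exact: trans_sub (candidates_sub l) tA.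
- by apply: candidates_large; [exact: S_notin|].
- by apply: leq_trans nc _; rewrite -[leqRHS]mulnA leq_mul2l cB orbT.
have neq x y : x \in B l -> y \in candidates l -> x != y.
  move=> /(subsetP (BC l)) xc yl; apply: contraTneq xc => ->.
  by rewrite (disjointFl (candidates_disjoint _) yl) // eq_sym.
have nf x y : x \in B l -> y \in candidates l -> ~~ forward e b x y.
  by move=> xB yl; move: xB; rewrite inE => /andP[_ /forall_inP]; apply.
move: nf; rewrite /forward; case: (b) => nf.
  by left=> y x yl xB; apply: (arc_total e_xor); [exact: neq|exact: nf].
right=> x y xB yl; apply: (arc_total e_xor); last exact: nf.
by rewrite eq_sym neq.
Qed.

Lemma star_embedding c : star_component theta C S c ->
  exists g, component_embedding g.
Proof.
move=> hS; have [_ _ hstar] := hS.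
have [b [[cS _ bgS] hb]] : exists b, induces_star theta S c /\
    {in S :\ c, forall l, (theta l < theta c) = b}.
  case: hstar => [[hi hl]|[hi hl]]; last by exists true; split.
  by exists false; split => // l lS; apply/negbTE; rewrite -leqNgt ltnW ?hl.
have [x xc hx] := star_center_pick b hS.
have [y hy] : exists y : H -> T, forall l, l \in S :\ c ->
    y l \in candidates l /\ forward e b x (y l).
  apply: (fin_all_exists (P := fun l w => l \in S :\ c ->
    w \in candidates l /\ forward e b x w)) => l.
  have [/hx[w wl xw]|_] := boolP (l \in S :\ c); first by exists w.
  (* An arbitrary value at vertices that are not leaves. *)
  by exists x.
exists (fun s => if s == c then x else y s); split.
  move=> s sS; exists s; split => //; case: eqVneq => [->//|sc].
  by have [|] := hy s; rewrite ?inE ?sc.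
have leaf l : l \in S -> l != c -> [/\ l \in S :\ c, (theta l < theta c) = b &
    tarc c l = b].
  move=> lS lc; have lSc : l \in S :\ c by rewrite !inE lc.
  have hl := hb l lSc; split => //.
  have bcl : bg c l by rewrite bgS // eqxx (negbTE lc).
  move: hl; case: (b) => hl; first by apply: bgraph_arc => //; rewrite bgraph_sym.
  apply/negbTE/tarc_asym; apply: bgraph_arc => //.
  by apply: theta_ltNge => //; rewrite hl.
move=> s s' sS s'S; case: (eqVneq s c) => [->|sc]; case: (eqVneq s' c) => [->|s'c].
- by rewrite tarc_irr.
- have [s'Sc _ ->] := leaf s' s'S s'c; have [_] := hy s' s'Sc.
  by rewrite /forward => h b1; rewrite b1 in h.
- have [sSc _ hcs] := leaf s sS sc; have [_] := hy s sSc.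
  rewrite /forward => h sc'; have := tarc_asym sc'; rewrite hcs => /negbTE b0.
  by rewrite b0 in h.
(* Two leaves are not adjacent in the backward graph, so their arc goes forward, as do all arcs
   between their sets. *)
move=> ss'; have nb : ~~ bg s s' by rewrite bgS // (negbTE sc) (negbTE s'c).
have lt := not_bgraph_lt nb ss'.
have [sSc _ _] := leaf s sS sc; have [s'Sc _ _] := leaf s' s'S s'c.
apply: (A_leaves hS sSc s'Sc lt).
  by apply: (subsetP (candidates_sub s)); have [] := hy s sSc.
by apply: (subsetP (candidates_sub s')); have [] := hy s' s'Sc.
Qed.

(** Common to left and right boats: [wk] is the vertex of the boat in whose candidate set the image
    [xk] of [vk] was found. *)
Lemma boat_embedding (v1 v2 v3 v4 : H) (x1 x2 x3 x4 : T) (w1 w2 w3 w4 : H) :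
  S = [set v1; v2; v3; v4] ->
  theta v1 < theta v2 -> theta v2 < theta v3 -> theta v3 < theta v4 ->
  induces_boat theta v1 v2 v3 v4 ->
  (forall v w x,
     (v, w, x) \in [:: (v1, w1, x1); (v2, w2, x2); (v3, w3, x3); (v4, w4, x4)] ->
    [/\ w \in S, x \in candidates w &
     forall i, i \notin S -> (theta v < theta i) = (theta w < theta i)]) ->
  [&& e x1 x2, e x2 x3, e x3 x4, e x3 x1, e x4 x1 & e x4 x2] ->
  exists g, component_embedding g.
Proof.
move=> SE l12 l23 l34 /and5P[b13 b14 b24 n12 /andP[n23 n34]] pos.
move=> /and5P[e12 e23 e34 e31 /andP[e41 e42]].
have l13 := ltn_trans l12 l23; have l24 := ltn_trans l23 l34.
have l14 := ltn_trans l12 l24.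
have a12 := not_bgraph_arc n12 l12; have a23 := not_bgraph_arc n23 l23.
have a34 := not_bgraph_arc n34 l34; have a31 := bgraph_arc b13 l13.
have a41 := bgraph_arc b14 l14; have a42 := bgraph_arc b24 l24.
have neq (u v : H) : theta u < theta v -> (v == u) = false.
  by move=> uv; apply/eqP => vu; rewrite vu ltnn in uv.
pose g s := if s == v1 then x1 else if s == v2 then x2 else
  if s == v3 then x3 else x4.
have g1 : g v1 = x1 by rewrite /g eqxx.
have g2 : g v2 = x2 by rewrite /g (neq v1) // eqxx.
have g3 : g v3 = x3 by rewrite /g (neq v1) // (neq v2) // eqxx.
have g4 : g v4 = x4 by rewrite /g !neq.
have S4 s : s \in S -> [\/ s = v1, s = v2, s = v3 | s = v4].
  by rewrite SE !inE -!orbA => /or4P[] /eqP->;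
    [constructor 1|constructor 2|constructor 3|constructor 4].
exists g; split.
  move=> s /S4[] ->; rewrite ?g1 ?g2 ?g3 ?g4.
  - by exists w1; apply: pos; rewrite in_cons eqxx.
  - by exists w2; apply: pos; rewrite !in_cons eqxx ?orbT.
  - by exists w3; apply: pos; rewrite !in_cons eqxx ?orbT.
  - by exists w4; apply: pos; rewrite !in_cons eqxx ?orbT.
have no := tarc_asym.
move=> s s' /S4[] -> /S4[] ->; rewrite ?g1 ?g2 ?g3 ?g4 ?tarc_irr //.
- by rewrite (negbTE (no _ _ a31)).
- by rewrite (negbTE (no _ _ a41)).
- by rewrite (negbTE (no _ _ a12)).
- by rewrite (negbTE (no _ _ a42)).
- by rewrite (negbTE (no _ _ a23)).
- by rewrite (negbTE (no _ _ a34)).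
Qed.

(** Candidates are at least half of [A i], whence the factor 2 before [64 * 64] in the bound on
    [L]. *)
Lemma boat_sparse (i j : H) (b : bool) : i != j -> i \notin Z -> j \notin Z ->
  (theta j < theta i) = b ->
  {in candidates j, forall y,
    64 * 64 * #|[set x in candidates i | ~~ forward e b y x]| <= #|candidates i|}.
Proof.
move=> ij iZ jZ hb y yj; rewrite eq_sym in ij.
have [_ h] := A_smooth ij; have := h y (subsetP (candidates_sub j) y yj).
rewrite hb => h'; have := candidates_card iZ.
have := leq_mul (leqnn (2 * (64 * 64))) (defect_sub e b y (candidates_sub i)).
have L' : 2 * (64 * 64) <= L by apply: leq_trans L_ge; apply: leq_addl.
have := leq_mul L' (leqnn (defect e b y (A i))).
move: h'; rewrite -!mulnA /defect; clear; lia.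
Qed.

Lemma left_boat_embedding : left_boat theta S -> exists g, component_embedding g.
Proof.
move=> hS; have [v1 [v2 [v3 [v4 [SE s12 s23 l34 hboat]]]]] := hS.
have l12 : theta v1 < theta v2 by rewrite s12.
have l23 : theta v2 < theta v3 by rewrite s23.
have l14 : theta v1 < theta v4 by rewrite (ltn_trans l12) // (ltn_trans l23).
have v1S : v1 \in S by rewrite SE !inE eqxx.
have v4S : v4 \in S by rewrite SE !inE eqxx orbT.
have v14 : v1 != v4 by apply: contraTneq l14 => ->; rewrite ltnn.
have large v : v \in S -> n <= 2 * D * #|candidates v|.
  move=> vS; apply: candidates_large; first exact: S_notin.
  by apply: A_long; right; exists S; split => //; left.
have [|x [u [v [y [[xX uX vX yW] /and3P[xu uv vx] /and3P[yx yu vy]]]]]] :=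
  left_boat_ex (candidates_V v1) (candidates_V v4) (candidates_disjoint v14)
    (large _ v1S) (large _ v4S).
  move=> y yW; apply: leq_trans (boat_sparse v14 (S_notin v1S) (S_notin v4S)
    (erefl _) yW); rewrite leq_mul2l subset_leq_card ?orbT //.
  apply/subsetP => x; rewrite !inE => /andP[-> yx] /=.
  by rewrite ltnNge ltnW //=; apply: (arc_asym e_irr e_xor).
(* The first three vertices are consecutive, so no vertex outside [S] separates them, and all three
   images may come from the candidates of [v1]. *)
apply: (@boat_embedding v1 v2 v3 v4 x u v y v1 v1 v1 v4) => //; last first.
  by rewrite xu uv vy vx yx yu.
have inS i : i \notin S -> [/\ theta i != theta v1 :> nat,
    theta i != theta v2 :> nat & theta i != theta v3 :> nat].
  move=> iS; split; apply: contraNneq iS => /theta_eq->; rewrite SE !inE eqxx ?orbT //.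
move=> v' w' x'; rewrite !in_cons orbF => /or4P[] /eqP[-> -> ->]; split => // i /inS[];
  rewrite ?s23 ?s12; clear; lia.
Qed.

Lemma right_boat_embedding : right_boat theta S -> exists g, component_embedding g.
Proof.
move=> hS; have [v1 [v2 [v3 [v4 [SE l12 s23 s34 hboat]]]]] := hS.
have l34 : theta v3 < theta v4 by rewrite s34.
have l23 : theta v2 < theta v3 by rewrite s23.
have l14 : theta v1 < theta v4 by rewrite (ltn_trans l12) // (ltn_trans l23).
have v1S : v1 \in S by rewrite SE !inE eqxx.
have v4S : v4 \in S by rewrite SE !inE eqxx orbT.
have v41 : v4 != v1 by apply: contraTneq l14 => ->; rewrite ltnn.
have large v : v \in S -> n <= 2 * D * #|candidates v|.
  move=> vS; apply: candidates_large; first exact: S_notin.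
  by apply: A_long; right; exists S; split => //; right.
have [|x [u [v [y [[xX uX vX yW] /and3P[ux vu xv] /and3P[xy uy yv]]]]]] :=
  right_boat_ex (candidates_V v4) (candidates_V v1) (candidates_disjoint v41)
    (large _ v4S) (large _ v1S).
  move=> y yW; apply: leq_trans (boat_sparse v41 (S_notin v4S) (S_notin v1S)
    (erefl _) yW); rewrite leq_mul2l subset_leq_card ?orbT //.
  apply/subsetP => x; rewrite !inE => /andP[-> yx] /=.
  by rewrite l14 /=; apply: (arc_asym e_irr e_xor).
(* [right_boat_ex] gives a boat of the reversed relation, hence the order [y], [v], [u], [x]. *)
apply: (@boat_embedding v1 v2 v3 v4 y v u x v1 v4 v4 v4) => //; last first.
  by rewrite yv vu ux uy xy xv.
have inS i : i \notin S -> [/\ theta i != theta v2 :> nat,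
    theta i != theta v3 :> nat & theta i != theta v4 :> nat].
  move=> iS; split; apply: contraNneq iS => /theta_eq->; rewrite SE !inE eqxx ?orbT //.
move=> v' w' x'; rewrite !in_cons orbF => /or4P[] /eqP[-> -> ->]; split => // i /inS[];
  rewrite ?s34 ?s23; clear; lia.
Qed.

Lemma component_embedding_ex : exists g, component_embedding g.
Proof.
have [hcomp _ _] := H_ord; case: (hcomp S S_comp).
- by case=> c; apply: star_embedding.
- exact: singleton_embedding.
- exact: left_boat_embedding.
- exact: right_boat_embedding.
Qed.

End Step.

Lemma flotilla_galaxy_embeds (t0 : T) : embeds e (@tarc H).
Proof.
have main m Z f : #|~: Z| <= m -> partial_embedding Z f -> embeds e (@tarc H).
  elim: m Z f => [|m IHm] Z f Zm Zf.
    move: Zm; rewrite leqn0 cards_eq0 => /eqP Z0; exists f => u v.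
    have inZ w : w \in Z by apply/negPn; rewrite -in_setC Z0 inE.
    by have [_ h _] := Zf; apply: h.
  have [Z0|/set0Pn[u]] := eqVneq (~: Z) set0.
    by apply: (IHm Z f) => //; rewrite Z0 cards0.
  rewrite inE => uZ; have Scomp := component_in u.
  have SZ : [disjoint component u & Z].
    have [Zcl _ _] := Zf; apply/pred0P => v /=; apply/negP => /andP[].
    rewrite inE => uv vZ; move: uZ; rewrite (closed_connect Zcl uv).
    by rewrite vZ.
  have [g hg] := component_embedding_ex Zf Scomp SZ.
  apply: (IHm _ _ _ (extend_partial_embedding Zf Scomp SZ hg)).
  rewrite -ltnS; apply: leq_trans Zm; apply: proper_card.
  apply/properP; split; first by rewrite setCS subsetUl.
  exists u; first by rewrite inE.
  by rewrite !inE connect0 orbT.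
apply: (main _ set0 (fun=> t0) (leqnn _)); split => //.
- by move=> u v _; rewrite !inE.
- by move=> u v; rewrite inE.
- by move=> u i; rewrite inE.
Qed.

End Embedding.

(** * Assigning sets to vertices *)

Section VertexSets.
Variables (H : tournament) (theta : H -> 'I_#|H|) (C : {set H}).
Hypotheses (theta_inj : injective theta)
           (H_ord : flotilla_galaxy_ordering theta C).

Local Notation long := (long_set_vertex theta C).

Lemma star_component_center S c : star_component theta C S c -> c \in S.
Proof. by case=> _ Cc _; have := set11 c; rewrite -Cc inE => /andP[]. Qed.

Lemma star_component_center_uniq S c c' : star_component theta C S c ->
  star_component theta C S c' -> c = c'.
Proof. by case=> _ Cc _ [_ Cc' _]; apply/set1P; rewrite -Cc' Cc inE. Qed.

Lemma leaf_not_long S c i : star_component theta C S c -> i \in S :\ c -> ~ long i.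
Proof.
move=> hS; rewrite !inE => /andP[ic iS]; have [Sb _ hstar] := hS.
case=> [[S' hS']|[S' [S'b iS' hboat]]].
  have [S'b _ _] := hS'; have iS' := star_component_center hS'.
  have eS := bcomponent_eq S'b Sb iS' iS; rewrite eS in hS'.
  by rewrite (star_component_center_uniq hS hS') eqxx in ic.
have eS := bcomponent_eq S'b Sb iS' iS; rewrite {}eS in hboat.
have {hstar} [cS _ bgS] : induces_star theta S c by case: hstar => -[].
(* A boat is not a star, as its edges [v1 v3] and [v2 v4] share no vertex that could be the
   centre. *)
suff [v1 [v2 [v3 [v4 [SE l12 l23 l34 /and5P[b13 _ b24 _ _]]]]]] :
    exists v1 v2 v3 v4, [/\ S = [set v1; v2; v3; v4], theta v1 < theta v2,
      theta v2 < theta v3, theta v3 < theta v4 & induces_boat theta v1 v2 v3 v4].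
  have neq (u v : H) : theta u < theta v -> (u == v) = false.
    by move=> uv; apply/eqP => vu; rewrite vu ltnn in uv.
  have n12 := neq _ _ l12; have n23 := neq _ _ l23; have n34 := neq _ _ l34.
  have n14 := neq _ _ (ltn_trans l12 (ltn_trans l23 l34)).
  rewrite !bgS ?SE ?inE ?eqxx ?orbT // in b13 b24.
  have [c1|c1] := eqVneq v1 c.
    by move: b24; rewrite -c1 eq_sym n12 eq_sym n14.
  move: b13; rewrite (negbTE c1) /= => /eqP c3.
  by move: b24; rewrite -c3 n23 eq_sym n34.
case: hboat => [[v1 [v2 [v3 [v4 [SE s12 s23 l34 hb]]]]]
               |[v1 [v2 [v3 [v4 [SE l12 s23 s34 hb]]]]]].
  by exists v1, v2, v3, v4; split; rewrite ?l34 ?hb // ?s23 ?s12.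
by exists v1, v2, v3, v4; split; rewrite ?l12 ?hb // ?s34 ?s23.
Qed.

(** Here the betweenness conditions on [H] enter. The centre of the same star is excluded because it
    lies on one side of all its leaves. *)
Lemma between_leaves_not_long S c u v k : star_component theta C S c ->
  u \in S :\ c -> v \in S :\ c -> theta u < theta k < theta v -> ~ long k.
Proof.
move=> hS uS vS ukv; have [_ _ hstar] := hS; have [_ Hstar Hboat] := H_ord.
have bt : between theta k u v by rewrite /between ukv.
case=> [[S' hS']|[S' [S'b kS' hboat]]]; last first.
  by have := Hboat _ _ _ S'b hboat hS k kS' u v uS vS; rewrite bt.
have [eS|nS] := eqVneq S' S.
  rewrite eS in hS'; move: ukv; rewrite -(star_component_center_uniq hS hS').
  case/andP=> uc cv; case: hstar => -[_ h].
    by move: (h u uS); rewrite ltnNge ltnW.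
  by move: (h v vS); rewrite ltnNge ltnW.
by have := Hstar _ _ _ _ hS' hS nS u v uS vS; rewrite bt.
Qed.

Definition long_before i := #|[set k | `[< long k >] && (theta k < theta i)]|.
(* Odd blocks will be linear sets, each for a single vertex; even blocks will
   be transitive sets, shared by all vertices between two consecutive long
   ones. *)
Definition block i := 2 * long_before i + `[< long i >].

Lemma block_lt i : block i < 2 * #|H| + 2.
Proof.
have : long_before i <= #|H| by apply: max_card.
by rewrite /block; case: `[< _ >]; clear; lia.
Qed.

Lemma block_mono i j : theta i < theta j -> block i <= block j /\
  (block i = block j -> ~ long i /\ ~ long j).
Proof.
move=> ij.
have [li|li] := asboolP (long i).
  have : long_before i < long_before j.
    apply: proper_card; apply/properP; split.
      by apply/subsetP => k; rewrite !inE => /andP[-> /= /ltn_trans]; apply.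
    by exists i; rewrite inE ?ltnn ?andbF // ij andbT; apply/asboolP.
  rewrite /block asboolT //; case: `[< _ >]; clear; [lia|lia].
have : long_before i <= long_before j.
  apply: subset_leq_card; apply/subsetP => k; rewrite !inE => /andP[-> /=].
  by move/ltn_trans; apply.
rewrite /block asboolF //; have [lj|lj] := asboolP (long j).
  by move=> h; split; move: h; clear; lia.
by move=> h; split=> //; rewrite !addn0 leq_mul2l h.
Qed.

(** Neither leaf is long and no long vertex lies between them, so the same long vertices precede
    both. *)
Lemma block_leaves S c u v : star_component theta C S c ->
  u \in S :\ c -> v \in S :\ c -> theta u < theta v -> block u = block v.
Proof.
move=> hS uS vS uv; rewrite /block.
rewrite !asboolF; [|exact: leaf_not_long hS vS|exact: leaf_not_long hS uS].
congr (2 * #|(_ : {set _})| + _); apply/setP => k; rewrite !inE.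
have [lk|//] := asboolP (long k); rewrite /=.
apply/idP/idP => [/ltn_trans|kv]; first exact.
rewrite ltn_neqAle leqNgt; apply/andP; split.
  by apply/eqP => /(theta_eq theta_inj) ku; rewrite ku in lk;
     apply: (leaf_not_long hS uS).
by apply/negP => uk; apply: (between_leaves_not_long hS uS vS _ lk); rewrite uk.
Qed.

Variables (T : finType) (e : rel T).
Hypotheses (e_irr : irreflexive e)
           (e_xor : forall u v, u != v -> e u v (+) e v u).
Variables (V : {set T}) (n t D L : nat) (B : nat -> {set T}).
Local Notation m := (2 * #|H| + 2).
Hypotheses (B_smooth : smooth e m (2 * #|H| * L) B)
  (B_size : forall i, i < m -> B i \subset V /\
     if ~~ odd i then trans e (B i) /\ t <= D * #|B i| else n <= D * #|B i|)
  (n_gt0 : 0 < n) (t_ge : D * #|H| <= t).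

(** A long vertex receives a whole odd block. A transitive block is cut into [#|H|] consecutive
    chunks, and the chunk numbered [theta i] goes to [i], which puts the sets sharing a block in the
    right order. Smoothness [2 * #|H| * L] covers the loss in size, and [t_ge] makes the chunks
    nonempty. *)
Lemma vertex_sets : exists A : H -> {set T},
  [/\ forall i, A i \subset V /\ 0 < #|A i|,
   forall i j, i != j -> [disjoint A i & A j] /\
     {in A i, forall x, L * defect e (theta i < theta j) x (A j) <= #|A j|},
   forall i, long i -> n <= D * (2 * #|H|) * #|A i|,
   forall S c, star_component theta C S c -> {in S :\ c, forall i,
     trans e (A i) /\ t <= D * (2 * #|H|) * #|A i|} &
   forall S c, star_component theta C S c ->
     {in S :\ c &, forall i j, theta i < theta j -> complete e (A i) (A j)}].
Proof.
have [h0|h0] := posnP #|H|.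
  have noH (i : H) : False by have := card0_eq h0 i; rewrite inE.
  by exists (fun=> set0); split=> [i|i|i|S c _ i|S c _ i]; case: (noH i).
pose h := #|H|.
have D0 : 0 < D.
  have [|_ /=] := B_size (_ : 1 < m); first by rewrite addn2.
  by case: D => //; rewrite mul0n leqNgt n_gt0.
have [K hK] : exists K : 'I_m -> nat -> {set T}, forall j : 'I_m, ~~ odd j ->
    [/\ forall i, i < h -> K j i \subset B j,
        forall i, i < h -> #|B j| <= 2 * h * #|K j i| &
        forall i i', i < i' < h -> complete e (K j i) (K j i')].
  apply: (@fin_all_exists 'I_m (fun=> nat -> {set T}) (fun j K => ~~ odd j ->
    [/\ forall i, i < h -> K i \subset B j,
        forall i, i < h -> #|B j| <= 2 * h * #|K i| &
        forall i i', i < i' < h -> complete e (K i) (K i')])) => j.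
  have [/negbTE oj|oj] := boolP (~~ odd j); last by exists (fun=> set0).
  have [_] := B_size (ltn_ord j); rewrite oj /= => -[tB tle].
  have hB : h <= #|B j| by rewrite -(leq_pmul2l D0) (leq_trans t_ge).
  have [|K [KB Kq Kc]] := @trans_chunks T e e_irr e_xor (B j) h (#|B j| %/ h) tB.
    by rewrite mulnC leq_trunc_div.
  exists K => _; split => // i ih; rewrite Kq //.
  by apply: leq_double_mul_divn; rewrite h0.
pose blk i : 'I_m := Ordinal (block_lt i).
pose A i := if `[< long i >] then B (block i) else K (blk i) (theta i).
have odd_block i : odd (block i) = `[< long i >].
  by rewrite /block oddD mul2n odd_double; case: `[< _ >].
have KP i : ~ long i -> [/\ A i = K (blk i) (theta i), A i \subset B (block i) &
    #|B (block i)| <= 2 * h * #|A i|].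
  move=> ni; rewrite /A asboolF //.
  have [|KB Kq _] := hK (blk i); first by rewrite odd_block asboolF.
  by split; [|apply: KB|apply: Kq].
have LP i : long i -> A i = B (block i) by move=> li; rewrite /A asboolT.
have AB i : A i \subset B (block i) /\ #|B (block i)| <= 2 * h * #|A i|.
  have [/LP->|/KP[]//] := pselect (long i).
  by split => //; rewrite leq_pmull // muln_gt0.
have sizeA u i : u <= D * #|B (block i)| -> u <= D * (2 * h) * #|A i|.
  move=> hu; apply: leq_trans hu _; rewrite -[leqRHS]mulnA leq_mul2l.
  by have [_ ->] := AB i; rewrite orbT.
have same i j : theta i < theta j -> block i = block j -> complete e (A i) (A j).
  move=> ij bij; have [_ /(_ bij)[ni nj]] := block_mono ij.
  have [-> _ _] := KP i ni; have [-> _ _] := KP j nj.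
  have -> : blk j = blk i by apply: val_inj; rewrite /= bij.
  have [|_ _ Kc] := hK (blk i); first by rewrite odd_block asboolF.
  by apply: Kc; rewrite ij /=.
have theta_neq i j : i != j -> theta i < theta j \/ theta j < theta i.
  move=> ij; case: (ltnP (theta i) (theta j)) => h'; [by left|right].
  by rewrite ltn_neqAle h' andbT; apply: contraNneq ij => /(theta_eq theta_inj)->.
exists A; split.
- move=> i; have [BV _] := B_size (block_lt i); have [AB' sz] := AB i.
  split; first exact: subset_trans BV.
  have [_] := B_size (block_lt i); case: ifP => _ => [[_ ht]|hn].
    have := sizeA _ _ ht; case: #|A i| => //; rewrite muln0 => t0'.
    by move: t_ge; rewrite leqNgt (leq_ltn_trans t0') // muln_gt0 D0.
  by have := sizeA _ _ hn; case: #|A i| => //; rewrite muln0 leqNgt n_gt0.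
- move=> i j ij; have [ABi szi] := AB i; have [ABj szj] := AB j.
  have [bij|bij] := eqVneq (block i) (block j).
    case: (theta_neq i j ij) => lt.
      have cij := same i j lt bij; split; first exact: complete_disjoint cij.
      move=> x xA; rewrite lt; suff -> : defect e true x (A j) = 0 by rewrite muln0.
      apply/eqP; rewrite cards_eq0; apply/eqP/setP => y; rewrite !inE.
      by case yA: (y \in A j) => //=; rewrite cij.
    have cji := same j i lt (esym bij); split.
      by rewrite disjoint_sym; apply: complete_disjoint cji.
    move=> x xA; have -> : (theta i < theta j) = false by rewrite ltnNge ltnW.
    suff -> : defect e false x (A j) = 0 by rewrite muln0.
    apply/eqP; rewrite cards_eq0; apply/eqP/setP => y; rewrite !inE.
    by case yA: (y \in A j) => //=; rewrite cji.
  have [dB sB] := B_smooth (block_lt i) (block_lt j) bij.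
  split; first by apply: disjointWl ABi _; apply: disjointWr ABj _.
  move=> x /(subsetP ABi) xB.
  have -> : (theta i < theta j) = (block i < block j).
    case: (theta_neq i j ij) => lt; have [le _] := block_mono lt.
      by rewrite lt ltn_neqAle bij le.
    by rewrite [LHS]ltnNge (ltnW lt) ltnNge le.
  rewrite -(@leq_pmul2l (2 * h)) ?muln_gt0 //; apply: leq_trans szj.
  apply: leq_trans (sB x xB); rewrite mulnA leq_mul2l defect_sub ?orbT //.
- move=> i li; apply: sizeA; have [_] := B_size (block_lt i).
  by rewrite odd_block asboolT.
- move=> S c hS i iS; have ni := leaf_not_long hS iS.
  have [_] := B_size (block_lt i); rewrite odd_block asboolF //= => -[tB tle].
  by split; [apply: trans_sub tB; have [] := AB i|apply: sizeA].
- by move=> S c hS i j iS jS ij; apply: same => //; apply: block_leaves hS iS jS ij.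
Qed.

End VertexSets.

Import Order.TTheory GRing.Theory Num.Theory.

(** * Critical sets and the boat lemma *)

Section CriticalSets.
Local Open Scope ring_scope.
Variables (R : realType) (eps : R).
Hypotheses (eps_gt0 : 0 < eps) (eps_small : eps <= 4^-1).

Lemma natpow_le (m n : nat) (a : R) : 0 <= a -> (m <= n)%N ->
  m%:R `^ a <= n%:R `^ a.
Proof.
by move=> a0 mn; apply: ge0_ler_powR; rewrite ?nnegrE ?ler_nat.
Qed.

(** With [z = s / w], [(1 - z)^(1 - eps) <= sqrt (1 - z) <= 1 - z / 2] because [1 - eps >= 1/2],
    while [w^(1 - eps) * z >= 1] by the lower bound on [s]. *)
Lemma powR_drop (w s : nat) : (0 < w)%N -> (s <= w)%N ->
  w%:R `^ eps <= s%:R :> R ->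
  2 * (w - s)%:R `^ (1 - eps) + 1 <= 2 * w%:R `^ (1 - eps) :> R.
Proof.
move=> w0 sw ws; have e4 := eps_small; have W0 : 0 < w%:R :> R by rewrite ltr0n.
set a := 1 - eps; pose z : R := s%:R / w%:R.
have z1 : z <= 1 by rewrite ler_pdivrMr // mul1r ler_nat.
have z0 : 0 <= z by rewrite divr_ge0.
have -> : (w - s)%:R = w%:R * (1 - z) :> R.
  by rewrite natrB // mulrBr mulr1 mulrC divfK // gt_eqF.
rewrite powRM ?subr_ge0 //.
have le1 : (1 - z) `^ a <= 1 - z / 2.
  have [z1'|z1'] := eqVneq z 1.
    by rewrite z1' subrr powR0; [lra|rewrite gt_eqF // /a; lra].
  have z2 : z < 1 by rewrite lt_neqAle z1'.
  apply: (@le_trans _ _ ((1 - z) `^ 2^-1)).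
    by apply: ger_powR; rewrite /a; [apply/andP; split; lra|lra].
  rewrite powR12_sqrt ?subr_ge0 // -[leRHS]ger0_norm -?sqrtr_sqr; last lra.
  by apply: ler_wsqrtr; nra.
have wa : 0 <= w%:R `^ a by apply: powR_ge0.
have wz : 1 <= w%:R `^ a * z.
  rewrite mulrA ler_pdivlMr // mul1r.
  apply: (@le_trans _ _ (w%:R `^ a * w%:R `^ eps)); last by rewrite ler_wpM2l.
  by rewrite -powRD /a ?subrK ?powRr1 // oner_eq0.
by have := ler_wpM2l wa le1; lra.
Qed.

Variables (T : finType) (e : rel T).
Hypotheses (e_irr : irreflexive e)
           (e_xor : forall u v, u != v -> e u v (+) e v u).
Variables (V : {set T}) (K : nat).

Definition critical : Prop :=
  (tr e V)%:R < #|V|%:R `^ eps /\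
  forall A : {set T}, A \proper V -> #|A|%:R `^ eps <= (tr e A)%:R.

Hypotheses (V_crit : critical) (K_gt0 : (0 < K)%N)
           (K_eps : K%:R `^ eps <= 1 + K%:R^-1).

Let eps_ge0 : 0 <= eps := ltW eps_gt0.

Let eps_le1 : eps <= 1.
Proof. by have e4 := eps_small; lra. Qed.

Lemma critical_tr_gt0 : (0 < tr e V)%N.
Proof.
have [V0|] := posnP #|V|.
  have [h _] := V_crit; move: h; rewrite V0 powR0 ?gt_eqF //.
  by rewrite ltNge ler0n.
rewrite -[X in (X <= _)%N]/(2 ^ 0)%N => h.
by apply: leq_trans (tr_log e_irr e_xor h).
Qed.

Lemma critical_tr_gt1 : (1 < tr e V)%N.
Proof.
have [h _] := V_crit; apply: (tr_log e_irr e_xor); rewrite expn1.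
apply: contraTT h; rewrite -leqNgt -leNgt => n1.
apply: (@le_trans _ _ 1); last by rewrite ler1n critical_tr_gt0.
have := @natpow_le #|V| 1 eps eps_ge0 n1; rewrite powR1; exact.
Qed.

Lemma natpow_leK (D : nat) : (D <= K)%N -> D%:R `^ eps <= 1 + K%:R^-1.
Proof. by move=> DK; apply: le_trans K_eps; apply: natpow_le. Qed.

Lemma invK_le1 : K%:R^-1 <= 1 :> R.
Proof. by rewrite invf_le1 ?ltr0n // ler1n. Qed.

(** For [#|V| <= K] the power [#|V|^eps] would be at most 2, hence at most [tr e V]. *)
Lemma critical_card_gt : (K < #|V|)%N.
Proof.
rewrite ltnNge; apply/negP => /natpow_leK h; have := invK_le1 => K1.
have [h1 _] := V_crit; have := critical_tr_gt1; rewrite -(ler_nat R); lra.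
Qed.

(** Only [A = V] needs the factor 2: deleting one vertex at most halves [V] and makes it a proper
    subset. *)
Lemma critical_sub (A : {set T}) : A \subset V ->
  #|A|%:R `^ eps <= 2 * (tr e A)%:R.
Proof.
move=> AV; have [_ hV] := V_crit.
have [/hV h|] := boolP (A \proper V).
  by apply: (le_trans h); rewrite mulr_natl mulr2n lerDl ler0n.
rewrite properEneq AV andbT negbK => /eqP->.
have n1 : (1 < #|V|)%N by apply: leq_trans critical_tr_gt1 (tr_leq_card _ _).
have /card_gt0P[v vV] : (0 < #|V|)%N by apply: ltnW.
have h := hV _ (properD1 vV).
have h2 : #|V|%:R `^ eps <= 2 `^ eps * #|V :\ v|%:R `^ eps.
  rewrite -powRM // -natrM; apply: natpow_le => //.
  by move: (cardsD1 v V); rewrite vV; lia.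
have h3 : 2 `^ eps <= 2 :> R by apply: ler1_powR; rewrite ?ler1n.
have h4 : (tr e (V :\ v))%:R <= (tr e V)%:R :> R.
  by rewrite ler_nat tr_mono // subD1set.
have h5 : 0 <= #|V :\ v|%:R `^ eps := powR_ge0 _ _.
have : 2 `^ eps * #|V :\ v|%:R `^ eps <= 2 * #|V :\ v|%:R `^ eps by rewrite ler_wpM2r.
lra.
Qed.

Lemma critical_transitive_subset (D : nat) (A : {set T}) :
  A \subset V -> (#|V| <= D * #|A|)%N ->
  exists X : {set T}, [/\ X \subset A, trans e X & (tr e V <= 2 * D * #|X|)%N].
Proof.
move=> AV nD; have [X [XA tX eX]] := tr_witness e A; exists X; split => //.
have D0 : (0 < D)%N.
  by case: D nD => //; rewrite mul0n; have := critical_card_gt; lia.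
have [h _] := V_crit.
have h1 : #|V|%:R `^ eps <= D%:R `^ eps * #|A|%:R `^ eps.
  by rewrite -powRM // -natrM; apply: natpow_le.
have h2 : D%:R `^ eps <= D%:R :> R by apply: ler1_powR; rewrite ?ler1n.
have h3 : 0 <= #|A|%:R `^ eps := powR_ge0 _ _.
have := critical_sub AV; rewrite -eX => h4.
have h5 : D%:R `^ eps * #|A|%:R `^ eps <= D%:R * #|A|%:R `^ eps by rewrite ler_wpM2r.
have h6 : D%:R * #|A|%:R `^ eps <= D%:R * (2 * #|X|%:R) by rewrite ler_wpM2l.
rewrite -(ler_nat R) !natrM; lra.
Qed.

(** Since [D2^eps <= 1 + 1/K], [tr e Y] exceeds [K / (K + 1)] times [tr e V]. Joining [X], of size
    at least [tr e V / K], would give a transitive set larger than [tr e V]. *)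
Lemma critical_no_complete (D1 D2 : nat) (X Y : {set T}) :
  X \subset V -> Y \subset V -> trans e X -> (D1 <= K)%N -> (D2 <= K)%N ->
  (tr e V <= D1 * #|X|)%N -> (#|V| <= D2 * #|Y|)%N ->
  complete e X Y \/ complete e Y X -> False.
Proof.
move=> XV YV tX D1K D2K hX hY XY.
have [h hV] := V_crit; have t0 := critical_tr_gt0.
have X0 : (0 < #|X|)%N by rewrite lt0n; apply: contraTneq hX => ->; rewrite muln0 -ltnNge.
have YpV : Y \proper V.
  apply/properP; split => //; have /card_gt0P[x xX] := X0.
  exists x; first exact: (subsetP XV _ xX).
  by apply/negP => xY; case: XY => /(_ x x); rewrite e_irr xX xY => /(_ isT isT).
have := tr_join e_irr e_xor XV YV tX XY => hj.
have h1 : #|V|%:R `^ eps <= D2%:R `^ eps * #|Y|%:R `^ eps.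
  by rewrite -powRM // -natrM; apply: natpow_le.
have h2 := natpow_leK D2K; have h3 : 0 <= #|Y|%:R `^ eps := powR_ge0 _ _.
have h4 := hV _ YpV.
have h5 : D2%:R `^ eps * #|Y|%:R `^ eps <= (1 + K%:R^-1) * #|Y|%:R `^ eps.
  by rewrite ler_wpM2r.
have h6 : (1 + K%:R^-1) * #|Y|%:R `^ eps <= (1 + K%:R^-1) * (tr e Y)%:R.
  by rewrite ler_wpM2l // addr_ge0 ?invr_ge0.
have K0 : 0 < K%:R :> R by rewrite ltr0n.
have : (K * tr e V < K.+1 * tr e Y)%N.
  rewrite -(ltr_nat R) !natrM -natr1.
  have -> : (K%:R + 1) * (tr e Y)%:R = K%:R * ((1 + K%:R^-1) * (tr e Y)%:R) :> R.
    by rewrite mulrA mulrDr mulfV ?gt_eqF // mulr1.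
  by rewrite ltr_pM2l //; lra.
have : (D1 * #|X| <= K * #|X|)%N by rewrite leq_mul2r D1K orbT.
have : (K * (#|X| + tr e Y) <= K * tr e V)%N by rewrite leq_mul2l hj orbT.
by clear - hX hj; rewrite mulSn mulnDr; lia.
Qed.


Section BoatLemma.
Variables (S W : {set T}) (D L : nat).
Hypotheses (SV : S \subset V) (WV : W \subset V) (SW : [disjoint S & W])
  (nS : (#|V| <= D * #|S|)%N) (nW : (#|V| <= D * #|W|)%N)
  (DK : (4 * D <= K)%N) (L_ge : (64 * 64 <= L)%N)
  (sparse : {in W, forall y, (L * #|[set x in S | e y x]| <= #|S|)%N}).

Let N y := [set x in S | e y x].

Hypothesis no_boat : forall x u v y, x \in S -> u \in S -> v \in S ->
  y \in W -> [&& e x u, e u v, e y x & e y u] -> e v y -> ~~ e v x.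

Let NS y : N y \subset S. Proof. by apply/subsetP => x; rewrite inE => /andP[]. Qed.

Let SWneq x y : x \in S -> y \in W -> x != y.
Proof. by move=> xS yW; apply: contraTneq xS => ->; rewrite (disjointFl SW). Qed.

Let no_cycle y : y \in W -> forall x u v, x \in N y -> u \in N y ->
  v \in S :\: N y -> e x u -> e u v -> ~~ e v x.
Proof.
move=> yW x u v; rewrite !inE => /andP[xS yx] /andP[uS yu] /andP[vN vS] xu uv.
rewrite vS /= in vN; apply: (@no_boat x u v y) => //; first by rewrite xu uv yx.
by apply: (arc_total e_xor) vN; rewrite eq_sym; apply: SWneq.
Qed.

Let cls y k := twin_class e S (N y) k.
Let f (w : nat) : R := 2 * w%:R `^ (1 - eps).
(* [f w] bounds the number of times a class of size [w] can be hit, see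
   [powR_drop]. *)
Let Phi (A : {set T}) : R := \sum_(y in W) \sum_k f #|A :&: cls y k|.

Let f_mono m n : (m <= n)%N -> f m <= f n.
Proof.
by move=> mn; rewrite ler_pM2l //; apply: natpow_le; rewrite ?subr_ge0.
Qed.

Let L_gt0 : 0 < L%:R :> R.
Proof. by rewrite ltr0n; apply: leq_trans L_ge. Qed.

Let D_gt0 : (0 < D)%N.
Proof.
rewrite lt0n; apply: contraTneq nS => ->; rewrite mul0n -ltnNge.
exact: leq_ltn_trans critical_card_gt.
Qed.

Let S_gt0 : (0 < #|S|)%N.
Proof.
rewrite lt0n; apply: contraTneq nS => ->; rewrite muln0 -ltnNge.
exact: leq_ltn_trans critical_card_gt.
Qed.

Let W_gt0 : (0 < #|W|)%N.
Proof.
rewrite lt0n; apply: contraTneq nW => ->; rewrite muln0 -ltnNge.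
exact: leq_ltn_trans critical_card_gt.
Qed.

Let cls_proper y k A : y \in W -> A :&: cls y k \proper V.
Proof.
move=> yW; apply/properP; split; last first.
  by exists y; rewrite ?(subsetP WV) // !inE e_irr andbF /= andbF.
by apply: subset_trans SV; apply: subset_trans (NS y); apply/subsetP => x;
   rewrite !inE => /andP[_ /andP[]].
Qed.

(** If [M] meets [N y], it meets some class. By exchange and criticality it removes at least [w^eps]
    of the [w] vertices of [A] in that class, so [powR_drop] gives a drop of 1; the other terms do
    not grow. *)
Let hit_drop (A M : {set T}) y : y \in W -> A \subset S -> M \subset A ->
  trans e M -> #|M| = tr e A ->
  (M :&: N y != set0)%:R + \sum_k f #|(A :\: M) :&: cls y k|
    <= \sum_k f #|A :&: cls y k|.
Proof.
move=> yW AS MA tM Mmax.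
have sub k : (A :\: M) :&: cls y k \subset A :&: cls y k.
  by apply: setSI; apply: subsetDl.
have [_|/set0Pn[x]] := eqVneq; first by rewrite add0r; apply: ler_sum => k _;
  apply: f_mono; apply: subset_leq_card.
rewrite inE => /andP[xM xN]; pose k0 := twin_key e S (N y) x.
have xk0 : x \in M :&: cls y k0 by rewrite inE xM /cls /twin_class inE xN /=.
rewrite (bigD1 k0) //= [leRHS](bigD1 k0) //= addrA; apply: lerD; last first.
  by apply: ler_sum => k _; apply: f_mono; apply: subset_leq_card.
have MkN : M :&: cls y k0 != set0 by apply/set0Pn; exists x.
have hs := twin_class_exchange e_irr e_xor (NS y) (no_cycle yW) AS MA tM Mmax MkN.
have [_ hV] := V_crit; have := hV _ (cls_proper k0 A yW).
have sM : M :&: cls y k0 \subset A :&: cls y k0 by apply: setSI.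
have -> : (A :\: M) :&: cls y k0 = (A :&: cls y k0) :\: (M :&: cls y k0).
  apply/setP => z; rewrite !(in_setD, in_setI).
  by case: (z \in M); case: (z \in A); case: (z \in cls y k0).
rewrite cardsDS // => h; rewrite addrC /f; apply: powR_drop.
- by apply/card_gt0P; exists x; apply: (subsetP sM).
- exact: subset_leq_card.
- by apply: le_trans h _; rewrite ler_nat.
Qed.

(** The set [M] is complete to those [y] in [W] with no out-neighbour in [M]. If they were half of
    [W], this would contradict [critical_no_complete]. *)
Let many_hit (A M : {set T}) : A \subset S -> M \subset A ->
  trans e M -> #|M| = tr e A -> (#|S| <= 2 * #|A|)%N ->
  (#|W| <= 2 * \sum_(y in W) (M :&: N y != set0))%N.
Proof.
move=> AS MA tM Mmax SA; rewrite leqNgt; apply/negP => few.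
have [tV _] := V_crit.
pose Y := [set y in W | M :&: N y == set0].
have YW : Y \subset W by apply/subsetP => y; rewrite inE => /andP[].
have cW : #|W| = (#|Y| + \sum_(y in W) (M :&: N y != set0))%N.
  rewrite -!sum1_card [X in _ = (X + _)%N]big_mkcond [X in (_ + X)%N]big_mkcond /=.
  rewrite -big_split /= big_mkcond; apply: eq_bigr => y _; rewrite inE.
  by case: (y \in W) => //=; case: eqP.
have AV : A \subset V := subset_trans AS SV.
apply: (@critical_no_complete (4 * D) (2 * D) M Y) => //.
- exact: subset_trans AV.
- exact: subset_trans WV.
- by apply: leq_trans DK; rewrite leq_mul2r orbT.
- have nA : (#|V| <= (2 * D) * #|A|)%N.
    by apply: leq_trans nS _; rewrite [(2 * D)%N]mulnC -mulnA leq_mul2l SA orbT.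
  have [X [XA tX]] := critical_transitive_subset AV nA.
  by rewrite Mmax => h; apply: leq_trans h _; rewrite mulnA leq_mul // leq_tr.
- apply: leq_trans nW _; rewrite [(2 * D)%N]mulnC -mulnA leq_mul2l.
  by apply/orP; right; clear - few cW; lia.
left=> x y xM; rewrite inE => /andP[yW /eqP/setP/(_ x)].
rewrite !inE xM (subsetP AS) ?(subsetP MA) //= => yx.
apply: (arc_total e_xor); last by rewrite yx.
by rewrite eq_sym SWneq // (subsetP AS) // (subsetP MA).
Qed.

(** Removing a largest transitive [M] from [A] lowers [#|A|] by at most [tr e V] and [Phi A] by at
    least [#|W| / 2], so the right side falls at least as much as the left. Once [A] has less than
    half of [S], the left side is not positive. *)
Let Phi_ge (A : {set T}) : A \subset S ->
  #|W|%:R * (2 * #|A|%:R - #|S|%:R) <= 4 * (tr e V)%:R * Phi A.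
Proof.
have Phi_ge0 B : 0 <= Phi B.
  by apply: sumr_ge0 => y _; apply: sumr_ge0 => k _; rewrite mulr_ge0 // powR_ge0.
have [m] := ubnP #|A|; elim: m A => // m IHm A Am AS.
have [SA|SA] := leqP #|S| (2 * #|A|); last first.
  apply: (@le_trans _ _ 0); last by rewrite !mulr_ge0.
  by rewrite mulr_ge0_le0 // subr_le0 -natrM ler_nat ltnW.
have [M [MA tM Mmax]] := tr_witness e A.
have hitM := many_hit AS MA tM Mmax SA.
have M_gt0 : (0 < #|M|)%N.
  rewrite lt0n; apply: contraTneq hitM => /eqP; rewrite cards_eq0 => /eqP->.
  by rewrite big1 ?muln0 -?ltnNge // => y _; rewrite set0I eqxx.
have AM : (#|A :\: M| < m)%N.
  have := subset_leq_card MA; rewrite cardsDS //; clear - Am M_gt0; lia.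
have := IHm _ AM (subset_trans (subsetDl _ _) AS).
have Phi_drop : (\sum_(y in W) (M :&: N y != set0))%:R + Phi (A :\: M) <= Phi A.
  rewrite natr_sum -big_split /=; apply: ler_sum => y yW; exact: hit_drop.
have MV : #|M|%:R <= (tr e V)%:R :> R.
  by rewrite Mmax ler_nat tr_mono // (subset_trans AS SV).
rewrite cardsDS // natrB ?subset_leq_card //.
move: hitM; rewrite -(ler_nat R) natrM => hitM h.
have t0 : 0 <= (tr e V)%:R :> R by [].
have h1 := ler_wpM2l t0 hitM; have h2 := ler_wpM2l t0 Phi_drop.
have h3 : #|W|%:R * #|M|%:R <= #|W|%:R * (tr e V)%:R :> R by rewrite ler_wpM2l.
nra.
Qed.

(** A class of size [w] has [w^(1 - eps) = w^(1 - 2 eps) * w^eps], where [w <= #|S| / L] by sparsity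
    and [w^eps] is at most its [tr] by criticality; these [tr] add up to at most [tr e V]. *)
Let Phi_le : Phi S <=
  #|W|%:R * (2 * (tr e V)%:R * (#|S|%:R / L%:R) `^ (1 - eps - eps)).
Proof.
rewrite mulr_natl -sumr_const; apply: ler_sum => y yW.
set P := _ `^ _; have P0 : 0 <= P by apply: powR_ge0.
apply: (@le_trans _ _ (\sum_k 2 * (P * (tr e (cls y k))%:R))); last first.
  rewrite -mulr_sumr -mulr_sumr -natr_sum -(mulrA 2) (mulrC _ P).
  rewrite ler_pM2l // ler_wpM2l // ler_nat.
  apply: leq_trans (sum_tr_twin_class e_xor (no_cycle yW)) _.
  by apply: tr_mono; apply: subset_trans (NS y) SV.
apply: ler_sum => k _; rewrite ler_pM2l //.
have [_ hV] := V_crit; have := hV _ (cls_proper k S yW).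
have -> : S :&: cls y k = cls y k.
  by apply/setIidPr; apply: subset_trans (NS y); apply/subsetP => x;
     rewrite inE => /andP[].
have e4 := eps_small.
move=> h; have [w0|w0] := posnP #|cls y k|.
  by rewrite w0 powR0 ?mulr_ge0 // gt_eqF //; lra.
have wn0 : #|cls y k|%:R != 0 :> R by rewrite pnatr_eq0 -lt0n.
have -> : 1 - eps = (1 - eps - eps) + eps by rewrite subrK.
rewrite powRD ?wn0 ?implybT //; apply: ler_pM => //; rewrite ?powR_ge0 //.
apply: ge0_ler_powR; rewrite ?nnegrE ?divr_ge0 //; first lra.
rewrite ler_pdivlMr // -natrM ler_nat mulnC; apply: leq_trans (sparse yW).
by rewrite leq_mul2l subset_leq_card ?orbT //; apply/subsetP => x /setIdP[].
Qed.

(** At [A = S] the two bounds on [Phi] give [s * L^b <= 8 t^2 s^b] with [b = 1 - 2 eps]. As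
    [b >= 1/2] and [L >= 64 * 64], the left side is at least [64 s]; as [t < 2 s^eps], the right
    side is below [32 s]. *)
Lemma no_boat_absurd : False.
Proof.
have e4 := eps_small; have := Phi_ge (subxx S).
have W0 : 0 < #|W|%:R :> R by rewrite ltr0n.
have S0 : 0 < #|S|%:R :> R by rewrite ltr0n.
have t0 : 0 < (tr e V)%:R :> R by rewrite ltr0n critical_tr_gt0.
move: Phi_le; set s := #|S|%:R; set b := 1 - eps - eps; set t := (tr e V)%:R.
have -> : (s / L%:R) `^ b = s `^ b * (L%:R `^ b)^-1.
  rewrite powRM ?invr_ge0 ?ltW //; congr (_ * _).
  by rewrite -[in LHS]powR_inv1 ?ltW // powRAC powR_inv1 ?powR_ge0.
have hL : 64 <= L%:R `^ b.
  apply: (@le_trans _ _ ((64 * 64)%:R `^ b)); last first.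
    by apply: natpow_le => //; rewrite /b; lra.
  apply: (@le_trans _ _ ((64 * 64)%:R `^ 2^-1)).
    by rewrite powR12_sqrt // natrM -expr2 sqrtr_sqr ger0_norm.
  by apply: ler_powR; rewrite ?ler1n // /b; lra.
have ht : t < 2 * s `^ eps.
  have [h _] := V_crit; apply: (lt_le_trans h).
  apply: (@le_trans _ _ ((D * #|S|)%:R `^ eps)); first exact: natpow_le.
  rewrite natrM powRM // ler_wpM2r ?powR_ge0 //.
  have DK' : (D <= K)%N by apply: leq_trans DK; rewrite leq_pmull.
  by apply: le_trans (natpow_leK DK') _; have := invK_le1; lra.
have hs : s = s `^ b * (s `^ eps * s `^ eps).
  have eb : b + (eps + eps) = 1 by rewrite /b; ring.
  have sn0 : s != 0 by rewrite gt_eqF.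
  rewrite -(@powRD _ s eps eps) ?sn0 ?implybT // -(@powRD _ s) ?sn0 ?implybT //.
  by rewrite eb powRr1 ?ltW.
set q := L%:R `^ b in hL *; set p := s `^ b in hs *; set r := s `^ eps in ht hs.
have p0 : 0 < p by apply: powR_gt0.
have r0 : 0 < r by apply: powR_gt0.
move=> h1 h2.
have q0 : 0 < q by lra.
have h3 : s <= 8 * t * t * (p / q).
  rewrite -(ler_pM2l W0).
  apply: (@le_trans _ _ (4 * t * (#|W|%:R * (2 * t * (p / q))))).
    have t4 : 0 <= 4 * t by rewrite mulr_ge0 // ltW.
    apply: le_trans (ler_wpM2l t4 h1); apply: le_trans h2.
    by rewrite (_ : 2 * s - s = s) //; ring.
  suff -> : 4 * t * (#|W|%:R * (2 * t * (p / q))) =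
    #|W|%:R * (8 * t * t * (p / q)) by [].
  by ring.
have h4 : s * q <= 8 * t * t * p by rewrite mulrA ler_pdivlMr in h3.
have h5 : s * 64 <= s * q by rewrite ler_wpM2l // ltW.
have h6 : t * t < (2 * r) * (2 * r) by apply: ltr_pM; rewrite ?ltW.
have h7 : t * t * p < 4 * s.
  by rewrite hs; have := h6; rewrite -(ltr_pM2r p0); lra.
by have := h4; lra.
Qed.
End BoatLemma.

End CriticalSets.

(** * Reversal of arcs, subtournaments, and existence of critical sets *)

Lemma trans_rev (T : finType) (e : rel T) (X : {set T}) :
  trans (fun x y => e y x) X = trans e X.
Proof.
by apply/transP/transP => h x y z xX yX zX xy yz; apply/negP => zx;
   move: (h z y x zX yX xX yz xy); rewrite zx.
Qed.

Lemma tr_rev (T : finType) (e : rel T) (X : {set T}) :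
  tr (fun x y => e y x) X = tr e X.
Proof. by apply: eq_bigl => Y; rewrite trans_rev. Qed.

(** A source among the vertices of a cycle would still have a predecessor on it. *)
Lemma trans_subtournament (T : tournament) (S : {set T}) :
  trans (@tarc T) S -> transitive_tournament (subtournament S).
Proof.
move=> tS p /andP[pc _]; have tP := elimT (transP _ S) tS.
have [//|p0] := eqVneq p [::]; exfalso.
pose X := [set x in p].
have tX : trans (@tarc (subtournament S)) X.
  by apply/transP => x y z _ _ _; apply: tP; apply: valP.
have X0 : X != set0.
  by case: p p0 @X {pc tX} => // x p _; apply/set0Pn; exists x; rewrite inE mem_head.
have [s sX hs] := trans_source (@tarc_irr _) (@tarc_xor _) tX X0.
rewrite inE in sX; have ps := prev_cycle pc sX.
have qX : prev p s \in X :\ s.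
  rewrite !inE mem_prev sX andbT; apply: contraTneq ps => ->.
  by rewrite tarc_irr.
by have := arc_asym (@tarc_irr _) (@tarc_xor _) ps; rewrite hs // set11.
Qed.

Lemma embeds_contains (T H : tournament) :
  embeds (@tarc T) (@tarc H) -> contains T H.
Proof.
case=> f hf.
have mono : {mono f : u v / tarc u v}.
  move=> u v; have [->|uv] := eqVneq u v; first by rewrite !tarc_irr.
  apply/idP/idP => [fuv|/hf//].
  apply/negPn/negP; move/(arc_total (@tarc_xor H)) => /(_ uv)/hf.
  by rewrite (negbTE (arc_asym (@tarc_irr T) (@tarc_xor T) fuv)).
have f_inj : injective f.
  move=> u v fuv; apply/eqP; apply/negPn/negP => /tarc_xor.
  by rewrite -!mono fuv tarc_irr.
pose S := [set f u | u : H].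
have fS u : f u \in S by apply: imset_f.
exists S, (fun u => exist _ (f u) (fS u)) => [|u v]; last exact: mono.
apply: inj_card_bij; first by move=> u v [/f_inj].
by rewrite card_sig (eq_card (B := mem S)) // card_imset.
Qed.

Section ExtractingCriticalSets.
Local Open Scope ring_scope.
Variable R : realType.

Lemma critical_rev (eps : R) (T : finType) (e : rel T) (V : {set T}) :
  critical eps e V -> critical eps (fun x y => e y x) V.
Proof. by case=> h1 h2; split=> [|A AV]; rewrite tr_rev //; apply: h2. Qed.

Lemma critical_exists (eps : R) (T : finType) (e : rel T) :
  (tr e [set: T])%:R < #|T|%:R `^ eps ->
  exists V : {set T}, critical eps e V.
Proof.
rewrite -cardsT => h.
pose P (V : {set T}) := (tr e V)%:R < #|V|%:R `^ eps.
have [V PV minV] := @arg_minnP _ [set: T] P (fun V : {set T} => #|V|) h.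
exists V; split => // A AV; rewrite leNgt; apply/negP => /minV.
by rewrite /= leqNgt proper_card.
Qed.

Lemma small_exponent (K : nat) : (0 < K)%N ->
  exists eps : R, [/\ 0 < eps, eps <= 4^-1 & K%:R `^ eps <= 1 + K%:R^-1].
Proof.
move=> K0; have Kr : 0 < K%:R :> R by rewrite ltr0n.
have l0 : 0 < ln (1 + K%:R^-1) :> R by rewrite ln_gt0 // ltrDl invr_gt0.
have l1 : 0 <= ln K%:R :> R by rewrite ln_ge0 // ler1n.
have l2 : 0 < ln K%:R + 1 :> R by rewrite ltr_wpDl.
(* The [+ 1] keeps the denominator positive when [K = 1]. *)
pose eps := Num.min (4^-1) (ln (1 + K%:R^-1) / (ln K%:R + 1)) : R.
exists eps; split.
- by rewrite lt_min invr_gt0 ltr0n divr_gt0.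
- by rewrite ge_min lexx.
rewrite /powR gt_eqF // -[leRHS]lnK ?posrE ?addr_gt0 ?invr_gt0 // ler_expR.
apply: (@le_trans _ _ (ln (1 + K%:R^-1) / (ln K%:R + 1) * ln K%:R)).
  by rewrite ler_wpM2r // ge_min lexx orbT.
by rewrite -mulrA ler_piMr ?(ltW l0) // ler_pdivrMl // mulr1 lerDl.
Qed.

Lemma critical_boat (eps : R) (T : finType) (e : rel T) (V X W : {set T}) (K D : nat) :
  0 < eps -> eps <= 4^-1 -> irreflexive e ->
  (forall u v, u != v -> e u v (+) e v u) -> critical eps e V ->
  (0 < K)%N -> K%:R `^ eps <= 1 + K%:R^-1 -> (4 * D <= K)%N ->
  X \subset V -> W \subset V -> [disjoint X & W] ->
  (#|V| <= D * #|X|)%N -> (#|V| <= D * #|W|)%N ->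
  {in W, forall y, (64 * 64 * #|[set x in X | e y x]| <= #|X|)%N} ->
  exists x u v y, [/\ [/\ x \in X, u \in X, v \in X & y \in W],
       [&& e x u, e u v & e v x] & [&& e y x, e y u & e v y]].
Proof.
move=> e0 e4 irr xor crit K0 Keps DK XV WV XW nX nW sparse.
apply: contrapT => none.
apply: (@no_boat_absurd R eps e0 e4 T e irr xor V K crit K0 Keps X W D (64 * 64)%N) => //.
move=> x u v y xX uX vX yW /and4P[xu uv yx yu] vy; apply/negP => vx.
by apply: none; exists x, u, v, y; split; rewrite ?xu ?uv ?vx ?yx ?yu ?vy.
Qed.
End ExtractingCriticalSets.

(** * Choice of the constants and conclusion *)

Local Open Scope ring_scope.

Theorem theorem7 (R : realType) (H : tournament) (hH : flotilla_galaxy H) :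
  exists2 eps : R, 0 < eps &
    forall T : tournament, tournament_free H T ->
      exists2 S : {set T}, transitive_tournament (subtournament S) &
        #|T|%:R `^ eps <= #|S|%:R :> R.
Proof.
have [theta [theta_inj [C H_ord]]] := hH.
pose h := #|H|; pose m := (2 * h + 2)%N; pose L := (2 * h + 2 * (64 * 64))%N.
(* [2 ^ m] is lost in [mixing] and [2 * h] in cutting transitive blocks into chunks. *)
pose L1 := (2 ^ m * (2 * h * L))%N.
(* The sequence has length [2 ^ m], of which the first [m] sets are used; its density is what
   [smoothing] requires. *)
have [D0 D0_gt0 hD0] := @dense_sequence H (@tarc H) m (2 * m * (2 * L1)).+1
  (@tarc_irr H) (@tarc_xor H) isT.
pose D1 := (2 ^ m * (2 * D0))%N; pose D2 := (D1 * (2 * h))%N.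
pose K := (8 * D2 + 2 * D2 * h + 2 ^ (D1 * h) + D0)%N.
have K_gt0 : (0 < K)%N by rewrite /K addn_gt0 D0_gt0 orbT.
(* [K] dominates every constant needed: [8 * D2] for boats, [2 * D2 * h] for stars, [2 ^ (D1 * h)]
   to make [tr] of the critical set at least [D1 * h], and [D0] for the dense sequence. *)
have [eps [eps0 eps4 Keps]] := small_exponent R K_gt0.
exists eps => // T T_free.
have [S [_ tS eS]] := tr_witness (@tarc T) [set: T].
exists S; first exact: trans_subtournament.
rewrite leNgt eS; apply/negP => /critical_exists[V crit].
have noemb : ~ embeds (@tarc T) (@tarc H) by move/embeds_contains.
have irr := @tarc_irr T; have xor := @tarc_xor T.
have irr' : irreflexive (fun x y => @tarc T y x) by move=> x; apply: irr.
have xor' (u v : T) : u != v -> tarc v u (+) tarc u v by rewrite addbC; apply: xor.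
have crit' := critical_rev crit.
have nK : (K < #|V|)%N := critical_card_gt eps0 irr xor crit K_gt0 Keps.
have n0 : (0 < #|V|)%N by apply: leq_ltn_trans nK.
have t0 : (0 < tr (@tarc T) V)%N := critical_tr_gt0 eps0 irr xor crit.
have m0 : (0 < m)%N by rewrite /m addn2.
have m2 i : (i < m)%N -> (i < 2 ^ m)%N by move=> im; apply: ltn_trans im (ltn_expl _ _).
have [|B [sB dB]] := hD0 T (@tarc T) irr xor noemb V.
  by apply: leq_trans (ltnW nK); apply: leq_addl.
have B_gt0 i : (i < m)%N -> (0 < #|B i|)%N.
  move=> /m2/sB[_]; case: #|B i| => //; rewrite muln0 leqNgt n0 //.
have [|B1 [smB1 sB1]] := @smoothing T (@tarc T) m L1 B m0 B_gt0.
- move=> i j /andP[ij jm]; have [|dij bij] := dB i j; first by rewrite ij m2.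
  by split => //; apply: leq_trans bij; rewrite leq_mul2r leqnSn orbT.
have hC1 := critical_transitive_subset eps0 eps4 irr xor crit K_gt0 Keps.
have D0' : (0 < 2 * D0)%N by rewrite muln_gt0.
have [|B2 [smB2 sB2]] := @mixing T (@tarc T) V (tr (@tarc T) V) #|V| m
  (2 * h * L) (2 * D0) B1 m D0' t0 hC1 n0 (leqnn m) smB1.
- move=> i im; have [BV nB] := sB i (m2 i im); have [B1B nB1] := sB1 i im.
  split; first exact: subset_trans B1B BV.
  by apply: leq_trans nB _; rewrite [(2 * D0)%N]mulnC -mulnA leq_mul2l nB1 orbT.
have [|||A [AV Asm Along Aleaf Aleaves]] := @vertex_sets H theta C theta_inj H_ord T
  (@tarc T) irr xor V #|V| (tr (@tarc T) V) D1 L B2 smB2.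
- by move=> i im; have := sB2 i im; rewrite im.
- exact: n0.
- apply/ltnW/(tr_log irr xor)/ltnW; apply: leq_ltn_trans nK.
  by apply: leq_trans (leq_addr _ _); apply: leq_addl.
apply: noemb; have /card_gt0P[x0 _] := n0.
have hK8 : (4 * (2 * D2) <= K)%N.
  have -> : (4 * (2 * D2) = 8 * D2)%N by rewrite mulnA.
  by do 2 apply: leq_trans (leq_addr _ _); apply: leq_addr.
have hK2 : (2 * D2 <= K)%N by apply: leq_trans hK8; rewrite leq_pmull.
have hKh : (2 * D2 * h <= K)%N.
  by do 2 apply: leq_trans (leq_addr _ _); apply: leq_addl.
apply: (@flotilla_galaxy_embeds H theta C theta_inj H_ord T (@tarc T) irr xor
  V A #|V| (tr (@tarc T) V) D2 L) => //.
- by move=> i; have [] := AV i.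
- by move=> i; have [] := AV i.
- move=> X Y XV YV tX hX hY XY.
  exact: (critical_no_complete eps0 irr xor crit K_gt0 Keps XV YV tX hK2 hKh hX hY XY).
- move=> X W; exact: (critical_boat eps0 eps4 irr xor crit K_gt0 Keps hK8).
(* Right boats are left boats of the reversed tournament, for which [V] is critical too. *)
- move=> X W XV WV XW nX nW sp.
  have [x [u [v [y [hin h1 h2]]]]] :=
    critical_boat eps0 eps4 irr' xor' crit' K_gt0 Keps hK8 XV WV XW nX nW sp.
  by exists x, u, v, y.
Qed.
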